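(* Let $X$ be a locally paracompact Hausdorff space and $\mathcal{E}\to X$ an $n$-homogeneous (F) Banach bundle. Then $$\inf\{d_{b\mathrm{BM}}(\mathcal{E},\mathcal{E}')\ :\ \mathcal{E}'\to X \text{ an } n\text{-homogeneous (F) Hilbert bundle}\}\le \tfrac12\log n.$$
   Context: Fix a ground field $\mathbb{F}\in\{\mathbb{R},\mathbb{C}\}$. A Banach bundle over $X$ is a continuous open surjection $\pi:\mathcal{E}\to X$ with a Banach-space structure on each fiber $\mathcal{E}_x=\pi^{-1}(x)$ such that scalar multiplication and fiberwise addition are continuous, the norm $\mathcal{E}\to\mathbb{R}_{\ge0}$ is continuous ((F) bundle), and for every $x$ the sets $\{p:\pi(p)\in U,\ \|p\|<\varepsilon\}$ ($U\ni x$ open, $\varepsilon>0$) form a fundamental system of neighbourhoods of $0_x$. A Hilbert bundle is a Banach bundle whose fiber norms come from inner products; $n$-homogeneous means all fibers have dimension $n$. A space is locally paracompact if every point has a closed paracompact neighbourhood. $\Gamma_b(\mathcal{E})$ is the Banach $C_b(X)$-module of bounded continuous sections with the supremum norm. A renorming $\mathcal{E}\to\mathcal{E}'$ is a homeomorphism $\Phi$ of total spaces commuting with the projections and linear on each fiber. The bounded Banach–Mazur distance is $d_{b\mathrm{BM}}(\mathcal{E},\mathcal{E}')=\log\inf_T\|T\|\,\|T^{-1}\|$, the infimum over all maps $T:\Gamma_b(\mathcal{E})\to\Gamma_b(\mathcal{E}')$, $T(s)=\Phi\circ s$, induced by renormings $\Phi$ for which $T$ is a bijection $\Gamma_b(\mathcal{E})\to\Gamma_b(\mathcal{E}')$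 that is bounded with bounded inverse (these are $C_b(X)$-module isomorphisms); the infimum of the empty set is $+\infty$. *)

(* Defs.v *)
From HB Require Import structures.
From mathcomp Require Import all_boot all_order all_algebra.
From mathcomp Require Import all_classical all_reals all_analysis.
From mathcomp.real_closed Require Import complex.
Import Order.TTheory GRing.Theory Num.Theory.
Import numFieldNormedType.Exports.

Set Implicit Arguments.
Unset Strict Implicit.
Unset Printing Implicit Defensive.

Local Open Scope classical_set_scope.
Local Open Scope ring_scope.

Record scalar_field (R : realType) := ScalarField {
  sc_K : numFieldType;
  sc_abs : sc_K -> R;
  sc_ofR : R -> sc_K;
  sc_conj : sc_K -> sc_K }.

Arguments sc_abs {R} s _.
Arguments sc_ofR {R} s _.
Arguments sc_conj {R} s _.

Definition real_scalars (R : realType) : scalar_field R :=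
  @ScalarField R R (fun a : R => `|a|) id id.

Definition complex_scalars (R : realType) : scalar_field R :=
  @ScalarField R R[i] (@Normc.normc R) (fun r : R => (r%:C)%C) (@conjc R).

Definition paracompact_subspace (X : topologicalType) (A : set X) : Prop :=
  forall (I : Type) (U : I -> set X),
    (forall i, open (U i)) -> A `<=` \bigcup_(i in setT) U i ->
    exists (J : Type) (V : J -> set X),
      [/\ (forall j, open (V j)),
          A `<=` \bigcup_(j in setT) V j,
          (forall j, exists i, V j `&` A `<=` U i) &
          (forall x, A x -> exists W, nbhs x W /\
              finite_set [set j | (V j `&` W `&` A) !=set0])].

Definition locally_paracompact (X : topologicalType) : Prop :=
  forall x : X, exists N : set X, [/\ nbhs x N, closed N & paracompact_subspace N].

(* The fiberwise operations are total functions on E; only their       *)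
(* values on (pairs of points of) a common fiber matter.               *)
Section Bundles.
Variables (R : realType) (S : scalar_field R) (X : topologicalType).
Local Notation K := (sc_K S).

Record bundle_data := BundleData {
  bd_E : topologicalType;
  bd_pi : bd_E -> X;
  bd_add : bd_E -> bd_E -> bd_E;
  bd_scale : K -> bd_E -> bd_E;
  bd_zero : X -> bd_E;
  bd_norm : bd_E -> R }.

Arguments bd_pi : clear implicits.
Arguments bd_add : clear implicits.
Arguments bd_scale : clear implicits.
Arguments bd_zero : clear implicits.
Arguments bd_norm : clear implicits.

Section OneBundle.
Variable B : bundle_data.
Local Notation E := (bd_E B).
Local Notation pi := (bd_pi B).
Local Notation add := (bd_add B).
Local Notation scale := (bd_scale B).
Local Notation zero := (bd_zero B).
Local Notation norm := (bd_norm B).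

Definition bd_sub (p q : E) : E := add p (scale (-1) q).

Definition bundle_projection_axioms : Prop :=
  [/\ continuous pi,
      (forall U : set E, open U -> open (pi @` U)) &
      (forall x : X, exists p : E, pi p = x)].

Definition fiber_ops_axioms : Prop :=
  [/\ (forall p q, pi p = pi q -> pi (add p q) = pi p),
      (forall a p, pi (scale a p) = pi p) &
      (forall x, pi (zero x) = x)].

Definition fiber_vector_space_axioms : Prop :=
  (forall p q r, pi p = pi q -> pi q = pi r ->
          add (add p q) r = add p (add q r)) /\
      (forall p q, pi p = pi q -> add p q = add q p) /\
      (forall p, add (zero (pi p)) p = p) /\
      (forall p, add p (scale (-1) p) = zero (pi p)) /\
      (forall a p q, pi p = pi q -> scale a (add p q) = add (scale a p) (scale a q)) /\
      (forall a b p, scale (a + b) p = add (scale a p) (scale b p)) /\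
      (forall a b p, scale a (scale b p) = scale (a * b) p) /\
      (forall p, scale 1 p = p).

Definition fiber_norm_axioms : Prop :=
  [/\ (forall p, 0 <= norm p),
      (forall p, norm p = 0 -> p = zero (pi p)),
      (forall a p, norm (scale a p) = sc_abs S a * norm p) &
      (forall p q, pi p = pi q -> norm (add p q) <= norm p + norm q)].

Definition fiber_complete : Prop :=
  forall (x : X) (u : nat -> E), (forall k, pi (u k) = x) ->
    (forall eps : R, 0 < eps -> exists N : nat, forall m k : nat,
        (N <= m)%N -> (N <= k)%N -> norm (bd_sub (u m) (u k)) < eps) ->
    exists p : E, pi p = x /\
      (forall eps : R, 0 < eps -> exists N : nat, forall k : nat,
        (N <= k)%N -> norm (bd_sub (u k) p) < eps).

Definition bundle_continuity_axioms : Prop :=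
  [/\ continuous (fun ap : K * E => scale ap.1 ap.2),
      {within [set pq : E * E | pi pq.1 = pi pq.2],
         continuous (fun pq : E * E => add pq.1 pq.2)} &
      continuous norm].

Definition zero_nbhs_axiom : Prop :=
  forall (x : X) (A : set E),
    nbhs (zero x) A <->
    exists (U : set X) (eps : R),
      [/\ open U, U x, 0 < eps & [set p | U (pi p) /\ norm p < eps] `<=` A].

Definition is_banach_bundle : Prop :=
  bundle_projection_axioms /\ fiber_ops_axioms /\ fiber_vector_space_axioms /\
  fiber_norm_axioms /\ fiber_complete /\ bundle_continuity_axioms /\
  zero_nbhs_axiom.

Definition is_hilbert_bundle : Prop :=
  is_banach_bundle /\
  exists inner : E -> E -> K,
    forall (a : K) (p q r : E), pi p = pi r -> pi q = pi r ->
      [/\ inner (add p q) r = inner p r + inner q r,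
          inner (scale a p) r = a * inner p r,
          inner r p = sc_conj S (inner p r) &
          inner p p = sc_ofR S (norm p ^+ 2)].

Definition homogeneous (n : nat) : Prop :=
  forall x : X, exists b : 'I_n -> E,
    (forall i, pi (b i) = x) /\
    (forall p, pi p = x -> exists! c : 'I_n -> K,
        p = \big[add/zero x]_(i < n) scale (c i) (b i)).

Definition bounded_section (s : X -> E) : Prop :=
  [/\ continuous s, (forall x, pi (s x) = x) &
      exists M : R, forall x, norm (s x) <= M].

(* supremum norm (0 is added so that it is 0 when X is empty) *)
Definition supnorm (s : X -> E) : R :=
  sup ([set 0] `|` [set norm (s x) | x in setT]).

End OneBundle.

Section TwoBundles.
Variables B B' : bundle_data.

Definition renorming (Phi : bd_E B -> bd_E B') : Prop :=
  [/\ continuous Phi,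
      (exists Psi : bd_E B' -> bd_E B,
          [/\ cancel Phi Psi, cancel Psi Phi & continuous Psi]),
      (forall p, bd_pi B' (Phi p) = bd_pi B p),
      (forall p q, bd_pi B p = bd_pi B q ->
          Phi (bd_add B p q) = bd_add B' (Phi p) (Phi q)) &
      (forall a p, Phi (bd_scale B a p) = bd_scale B' a (Phi p))].

Definition admissible_renorming (Phi : bd_E B -> bd_E B') : Prop :=
  [/\ renorming Phi,
      (forall s, bounded_section s -> bounded_section (Phi \o s)),
      (forall s', bounded_section s' ->
          exists s, bounded_section s /\ s' = Phi \o s),
      (exists C : R, forall s, bounded_section s ->
          supnorm (Phi \o s) <= C * supnorm s) &
      (exists C : R, forall s, bounded_section s ->
          supnorm s <= C * supnorm (Phi \o s))].

Definition opnorm_T (Phi : bd_E B -> bd_E B') : \bar R :=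
  ereal_sup [set (supnorm (Phi \o s))%:E |
             s in [set s | bounded_section s /\ supnorm s <= 1]].

(* ||T^-1||: T^-1 (Phi \o s) = s, and the unit ball of Gamma_b(E') is   *)
(* { Phi \o s | s in Gamma_b(E), ||Phi \o s|| <= 1 } since T is onto    *)
Definition opnorm_Tinv (Phi : bd_E B -> bd_E B') : \bar R :=
  ereal_sup [set (supnorm s)%:E |
             s in [set s | bounded_section s /\ supnorm (Phi \o s) <= 1]].

(* bounded Banach-Mazur distance (inf of the empty set is +oo;         *)
(* lne is the extended natural logarithm, lne 0 = -oo, lne +oo = +oo)  *)
Definition dbBM : \bar R :=
  lne (ereal_inf [set (opnorm_T Phi * opnorm_Tinv Phi)%E |
                  Phi in [set Phi | admissible_renorming Phi]]).

End TwoBundles.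
End Bundles.

(* Main.v *)
(**
The new norm lives on the same total space.  In each fiber, replace the unit
ball by the ellipsoid of maximal volume contained in it: by John's theorem this
changes the norm by a factor at most [sqrt n], so the identity of E is a renorming
of distortion at most [sqrt n], and everything reduces to the continuity of the
new norm on E.

An ellipsoid inside the unit ball of N is encoded by a Hermitian matrix P with [N (u
P)^2 <= Re (u P u^h)] for all row vectors u, where [^h] is the conjugate transpose. By
convexity of the square this is a convex condition on P, and it holds for [v^h v]
whenever [N v <= 1]. If P maximises the determinant, mixing a little of [v^h v] into P
cannot increase the determinant, which gives [v P^-1 v^h <= n]: John's theorem.
Simultaneous diagonalisation makes the strict log-concavity of the determinant
quantitative: norms within a factor t close to 1 have maximisers that are close.

Continuity then needs no local sections: since the projection is open, a basis of
the fiber at x can be approximated by families q in all nearby fibers, and by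
compactness of the sphere the norms [c |-> |sum c_i q_i|] are within a factor t of
[c |-> |sum c_i b_i|].
*)
Require Import Defs.
From HB Require Import structures.
From mathcomp Require Import all_boot all_order all_algebra.
From mathcomp Require Import all_classical all_reals all_analysis.
From mathcomp.real_closed Require Import complex.
From mathcomp Require Import ring lra.
Import Order.TTheory GRing.Theory Num.Theory.
Import numFieldNormedType.Exports.
Local Open Scope classical_set_scope.
Local Open Scope ring_scope.
Local Open Scope sesquilinear_scope.

Set Implicit Arguments.
Unset Strict Implicit.
Unset Printing Implicit Defensive.

(** * Quantitative log-concavity of the determinant *)

Lemma invmx_mul (K : comUnitRingType) n (A B : 'M[K]_n) :
  A \in unitmx -> B \in unitmx -> invmx (A *m B) = invmx B *m invmx A.
Proof.
move=> Au Bu; have ABu : A *m B \in unitmx by rewrite unitmx_mul Au.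
by rewrite -[RHS](mulKmx ABu) !mulmxA (mulmxK Bu) (mulmxK Au).
Qed.

(** The factors [(1 + l i)^2 / (4 * l i)] are all at least 1 and their product is at most [tau], so
    each single factor is at most [tau]. The bound imposed on [tau] is the value of this factor at
    [l i = 1 / (1 + d)]. *)
Lemma diag_gap_bound (R : realFieldType) n (l : 'I_n -> R) (tau d : R) :
  (forall i, 0 < l i) -> \prod_i (1 + l i) <= 2 ^+ n ->
  1 <= tau * \prod_i l i -> 0 < d -> tau <= 1 + d ^+ 2 / (4 * (1 + d)) ->
  forall i, (l i)^-1 <= 1 + d.
Proof.
move=> l_gt0 prod_le le_prod d_gt0 tau_le j.
(* [4^n prod l_i <= prod (1 + l_i)^2] termwise, with total loss at most [tau] *)
pose f i := (1 + l i) ^+ 2 / (4 * l i).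
have f_ge1 i : 1 <= f i.
  rewrite /f ler_pdivlMr ?mul1r; last by rewrite mulr_gt0 // ltr0n.
  by have := sqr_ge0 (1 - l i); nra.
have prod_f_le : \prod_i f i <= tau.
  rewrite /f prodf_div prodrXl big_split /= prodr_const card_ord.
  have pl0 : 0 < \prod_i l i by apply: prodr_gt0.
  rewrite ler_pdivrMr ?mulr_gt0 ?exprn_gt0 ?ltr0n //.
  have -> : tau * (4 ^+ n * \prod_i l i) = (tau * \prod_i l i) * (2 ^+ n) ^+ 2.
    by rewrite -exprM mulnC exprM (_ : 2 ^+ 2 = 4 :> R) ?mulrA 1?mulrAC //; lra.
  have h1 : 0 <= \prod_i (1 + l i).
    by apply: prodr_ge0 => i _; rewrite addr_ge0 // ltW.
  have h2 : (\prod_i (1 + l i)) ^+ 2 <= (2 ^+ n) ^+ 2.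
    by rewrite ler_pXn2r // nnegrE // exprn_ge0.
  by apply: (le_trans h2); rewrite ler_peMl // exprn_ge0 // exprn_ge0.
have f_le : f j <= tau.
  apply: le_trans prod_f_le; rewrite (bigD1 j) //=.
  rewrite ler_peMr //; first exact: le_trans ler01 (f_ge1 j).
  by apply: (big_ind (fun x => 1 <= x)) => // x y x1 y1; nra.
have lj0 := l_gt0 j.
have {}f_le := le_trans f_le tau_le.
rewrite leNgt; apply/negP => lt_inv.
have l_small : l j * (1 + d) < 1.
  by move: lt_inv; rewrite -[(l j)^-1]mul1r ltr_pdivlMr // mulrC.
move: f_le; rewrite /f ler_pdivrMr ?mulr_gt0 //.
have d1 : 0 < 1 + d by rewrite addr_gt0.
rewrite -(ler_pM2r d1) => h.
have e : (1 + d ^+ 2 / (4 * (1 + d))) * (4 * l j) * (1 + d) =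
    (4 * (1 + d) + d ^+ 2) * l j.
  by field; rewrite gt_eqF.
rewrite e in h.
(* The inequality is quadratic in [l j] with roots [1 / (1 + d)] and [1 + d]; it fails below the
   smaller root. *)
have : (1 - l j * (1 + d)) * (1 + d - l j) <= 0 by nra.
have : 0 < 1 + d - l j by nra.
nra.
Qed.

(** * Positive definite complex matrices and their simultaneous diagonalisation *)

Section ComplexForms.
Variable C : numClosedFieldType.

Definition posdefmx n (A : 'M[C]_n) :=
  A ^t* = A /\ forall u : 'rV_n, u != 0 -> 0 < (u *m A *m u ^t*) 0 0.

Lemma form_diag n (l v : 'rV[C]_n) :
  (v *m diag_mx l *m v ^t*) 0 0 = \sum_i l 0 i * `|v 0 i| ^+ 2.
Proof.
rewrite mxE; apply: eq_bigr => i _.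
by rewrite mul_mx_diag !mxE mulrAC -normCK mulrC.
Qed.

(** Each eigenvalue is the value of the form at the corresponding row of the unitary matrix, hence
    positive. *)
Lemma posdefmx_spectral n (A : 'M[C]_n) : posdefmx A ->
  exists U l, [/\ U \is unitarymx, forall i, 0 < (l : 'rV_n) 0 i &
    A = U ^t* *m diag_mx l *m U].
Proof.
move=> [hA pA].
have Ah : A \is hermsymmx by apply/is_hermitianmxP; rewrite expr0 scale1r.
have /hermitian_normalmx/orthomx_spectralP := Ah.
set U := spectralmx A; set l := spectral_diag A.
have Uu : U \is unitarymx by exact: spectral_unitarymx.
rewrite (invmx_unitary Uu) => eA; exists U, l; split => // i.
have e1 : row i U *m A *m (row i U) ^t* = row i (diag_mx l *m U *m U^t*) *m delta_mx i 0.
  rewrite -!row_mul -colE eA !mulmxA (unitarymxP Uu) mul1mx.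
  apply/matrixP => a b; rewrite !ord1 !mxE.
  by apply: eq_bigr => k _; rewrite !mxE.
have ui0 : row i U != 0.
  apply/eqP => u0; have /unitarymxP/matrixP/(_ i i) := Uu.
  rewrite !mxE eqxx big1 => [/esym/eqP|k _]; first by rewrite oner_eq0.
  by have /rowP/(_ k) := u0; rewrite !mxE => ->; rewrite mul0r.
have := pA _ ui0; rewrite e1 mulmxtVK // -colE !mxE eqxx mulr1n.
by [].
Qed.

Lemma posdefmx_unit n (A : 'M[C]_n) : posdefmx A -> A \in unitmx.
Proof.
move=> [hA pA]; rewrite -row_free_unit -kermx_eq0.
apply/rowV0P => v /sub_kermxP vA0; apply/eqP/negP => /negP/pA.
by rewrite vA0 mul0mx mxE ltxx.
Qed.

(** Square roots of the eigenvalues factor [B] through some [G0]. The form [A] read in the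
    coordinates of [G0] is then diagonalised by a unitary matrix, and multiplying [G0] by a unitary
    does not disturb the factorisation of [B]. *)
Lemma posdefmx_simultaneous n (A B : 'M[C]_n) : posdefmx A -> posdefmx B ->
  exists G l, [/\ G \in unitmx, forall i, 0 < (l : 'rV_n) 0 i,
    A = G *m diag_mx l *m G ^t* & B = G *m G ^t*].
Proof.
move=> pdA pdB; have [U [b [Uu b0 eB]]] := posdefmx_spectral pdB.
pose s : 'rV[C]_n := \row_i sqrtC (b 0 i).
have sb : diag_mx s *m (diag_mx s)^t* = diag_mx b.
  rewrite tr_diag_mx map_diag_mx mulmx_diag; congr diag_mx.
  apply/rowP => i; rewrite !mxE /= conj_Creal ?ger0_real ?sqrtC_ge0 ?(ltW (b0 _)) //.
  by rewrite -expr2 sqrtCK.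
pose G0 := U^t* *m diag_mx s.
have eB0 : B = G0 *m G0^t*.
  by rewrite /G0 trmx_mul map_mxM trmxCK mulmxA -(mulmxA (U^t*)) sb.
have G0u : G0 \in unitmx.
  by have := posdefmx_unit pdB; rewrite eB0 unitmx_mul => /andP[].
have G0cu : G0^t* \in unitmx.
  by have := posdefmx_unit pdB; rewrite eB0 unitmx_mul => /andP[].
have invc : (invmx G0)^t* = invmx (G0^t*) by rewrite trmx_inv map_invmx.
have [|V [l [Vu l0 eA]]] := @posdefmx_spectral _ (invmx G0 *m A *m (invmx G0)^t*).
  split; first by rewrite !trmx_mul !map_mxM trmxCK pdA.1 mulmxA.
  move=> u u0; have := pdA.2 (u *m invmx G0).
  rewrite trmx_mul map_mxM !mulmxA; apply.
  by apply: contra_neq u0 => /(congr1 (mulmx^~ G0)); rewrite mulmxKV // mul0mx.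
exists (G0 *m V^t*), l; split => //.
- by rewrite unitmx_mul G0u /= unitarymx_unit // trmxC_unitary.
- transitivity (G0 *m (invmx G0 *m A *m (invmx G0)^t*) *m G0^t*).
    by rewrite invc !mulmxA mulmxV // mul1mx -mulmxA mulVmx // mulmx1.
  by rewrite eA [in RHS]trmx_mul map_mxM trmxCK !mulmxA.
- rewrite [in RHS]trmx_mul map_mxM trmxCK mulmxA -(mulmxA G0).
  by rewrite -[X in G0 *m (_ *m X)]trmxCK (unitarymxP _) ?mulmx1 // trmxC_unitary.
Qed.

End ComplexForms.

(** In coordinates where [B] is the identity and [A] is diagonal with entries [l], the two
    determinant hypotheses become those of [diag_gap_bound], and the conclusion compares the weights
    [1 / l i] with 1. In the application [B] maximises the determinant and [A] is a competitor: the
    first hypothesis says that their midpoint does no better than [B]. *)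
Lemma posdefmx_inv_form_le (R : realType) n (A B : 'M[R[i]]_n) (tau d : R) :
  posdefmx A -> posdefmx B -> \det (A + B) <= 2 ^+ n * \det B ->
  \det B <= tau%:C%C * \det A -> 0 < d -> tau <= 1 + d ^+ 2 / (4 * (1 + d)) ->
  forall u : 'rV_n, (u *m invmx A *m u ^t*) 0 0 <=
    (1 + d)%:C%C * (u *m invmx B *m u ^t*) 0 0.
Proof.
move=> pdA pdB detAB detBA d0 tau_le u.
have [G [l [Gu l0 eA eB]]] := posdefmx_simultaneous pdA pdB.
pose lr i := complex.Re (l 0 i).
have elr i : l 0 i = (lr i)%:C%C by rewrite RRe_real // ger0_real // ltW.
have lr0 i : 0 < lr i by rewrite -ltcR -elr.
have Gcu : G^t* \in unitmx.
  by have := posdefmx_unit pdB; rewrite eB unitmx_mul => /andP[].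
have detG : \det (G^t*) = (\det G)^*%C by rewrite det_map_mx det_tr.
have dG0 : 0 < \det G * (\det G)^*%C.
  by rewrite lt_def mulcJ_ge0 mulf_neq0 ?conjc_eq0 // -unitfE -unitmxE.
have edetA : \det A = \det G * (\det G)^*%C * \prod_i l 0 i.
  by rewrite eA !det_mulmx det_diag detG mulrAC.
have edetB : \det B = \det G * (\det G)^*%C by rewrite eB det_mulmx detG.
have edetAB : \det (A + B) = \det G * (\det G)^*%C * \prod_i (1 + l 0 i).
  rewrite eA eB -[X in _ + X *m _]mulmx1 -mulmxDl -mulmxDr -diag_const_mx -raddfD.
  rewrite !det_mulmx det_diag detG mulrAC; congr (_ * _).
  by apply: eq_bigr => i _; rewrite !mxE addrC.
have inv_le : forall i, (lr i)^-1 <= 1 + d.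
  apply: (diag_gap_bound (tau := tau)) => //.
  - rewrite -lecR rmorph_prod rmorphXn rmorph_nat.
    rewrite -(ler_pM2l dG0) [leRHS]mulrC -edetB; apply: le_trans _ detAB.
    rewrite edetAB; under [in leRHS]eq_bigr do rewrite elr -(rmorph1 (real_complex R)) -rmorphD.
    by rewrite edetB.
  - rewrite -lecR rmorphM rmorph_prod rmorph1.
    rewrite -(ler_pM2l dG0) mulr1 mulrCA -edetB; apply: le_trans detBA _.
    by rewrite edetA edetB; under [in leLHS]eq_bigr do rewrite elr.
pose v := u *m invmx (G^t*).
have ev : v^t* = invmx G *m u^t*.
  by rewrite /v trmx_mul map_mxM trmx_inv map_invmx trmxCK.
have lu : diag_mx l \in unitmx.
  by rewrite unitmxE det_diag unitfE; apply/prodf_neq0 => i _; rewrite gt_eqF.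
have eAv : u *m invmx A *m u^t* = v *m invmx (diag_mx l) *m v^t*.
  by rewrite ev /v eA !invmx_mul ?unitmx_mul ?Gu ?lu // !mulmxA.
have eBv : u *m invmx B *m u^t* = v *m diag_mx (const_mx 1) *m v^t*.
  by rewrite diag_const_mx mulmx1 ev /v eB invmx_mul // !mulmxA.
have el : invmx (diag_mx l) = diag_mx (\row_i (lr i)^-1%:C%C).
  rewrite -[RHS](mulKmx lu) mulmx_diag -[LHS]mulmx1; congr (_ *m _).
  rewrite -diag_const_mx; congr diag_mx; apply/rowP => i.
  by rewrite !mxE elr -rmorphM mulfV ?rmorph1 // gt_eqF.
rewrite eAv eBv el !form_diag mulr_sumr; apply: ler_sum => i _.
rewrite !mxE mul1r ler_wpM2r ?exprn_ge0 // lecR; exact: inv_le.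
Qed.

(** * Hermitian forms over the ground field *)

(* Realises both ground fields inside R[i], so that one argument serves both. *)
Record hermitian_embedding (R : realType) (K : numFieldType) := HermitianEmbedding {
  he_conj : {rmorphism K -> K};
  he_iota : {rmorphism K -> R[i]};
  he_ofR : R -> K;
  he_conjE : forall a, he_iota (he_conj a) = (he_iota a)^*%C;
  he_ofRE : forall r, he_iota (he_ofR r) = r%:C%C;
  he_cases : (forall a, he_conj a = a) \/ (forall z, exists a, he_iota a = z);
  he_continuous_conj : continuous he_conj;
  he_continuous_Re : continuous (fun a => complex.Re (he_iota a));
  he_continuous_abs : continuous (fun a => Normc.normc (he_iota a));
  he_compact : forall M : R, compact [set a | Normc.normc (he_iota a) <= M] }.

Section Forms.
Variables (R : realType) (K : numFieldType) (H : hermitian_embedding R K).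
Local Notation cj := (he_conj H).
Local Notation iota := (he_iota H).
Local Notation ofR := (he_ofR H).
Local Notation "M ^h" := (M ^t cj) (at level 30).

Definition re (a : K) : R := complex.Re (iota a).
Definition ab (a : K) : R := Normc.normc (iota a).

Lemma cjK a : cj (cj a) = a.
Proof. by apply: (fmorph_inj iota); rewrite !he_conjE conjcK. Qed.

Lemma re_is_additive : {morph re : a b / a + b}.
Proof. by move=> a b; rewrite /re rmorphD; case: (iota a) (iota b) => ? ? []. Qed.

Lemma re0 : re 0 = 0. Proof. by rewrite /re rmorph0. Qed.

Lemma re_ofRM r a : re (ofR r * a) = r * re a.
Proof. by rewrite /re rmorphM he_ofRE; case: (iota a) => x y /=; rewrite mul0r subr0. Qed.

Lemma re_ofR r : re (ofR r) = r. Proof. by rewrite /re he_ofRE. Qed.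

Lemma cj_ofR r : cj (ofR r) = ofR r.
Proof. by apply: (fmorph_inj iota); rewrite he_conjE he_ofRE conjc_real. Qed.

Lemma re_cj a : re (cj a) = re a.
Proof. by rewrite /re he_conjE; case: (iota a). Qed.

Lemma ofR1 : ofR 1 = 1.
Proof. by apply: (fmorph_inj iota); rewrite he_ofRE !rmorph1. Qed.

Lemma ofRD r s : ofR (r + s) = ofR r + ofR s.
Proof. by apply: (fmorph_inj iota); rewrite rmorphD /= !he_ofRE -rmorphD. Qed.

Lemma ofRM r s : ofR (r * s) = ofR r * ofR s.
Proof. by apply: (fmorph_inj iota); rewrite rmorphM /= !he_ofRE -rmorphM. Qed.

Lemma iota_re a : cj a = a -> iota a = (re a)%:C%C.
Proof.
move=> /(congr1 iota); rewrite he_conjE /re; case: (iota a) => x y [] yy.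
by congr Complex; lra.
Qed.

Lemma ofR_re a : cj a = a -> ofR (re a) = a.
Proof. by move=> /iota_re e; apply: (fmorph_inj iota); rewrite he_ofRE. Qed.

Lemma ab_ge0 a : 0 <= ab a.
Proof. by rewrite /ab -lecR (normr_ge0 (iota a)). Qed.

Lemma ab0 : ab 0 = 0. Proof. by rewrite /ab rmorph0 Normc.normc0. Qed.

Lemma ab_eq0 a : ab a = 0 -> a = 0.
Proof. by move=> /Normc.eq0_normc/eqP; rewrite fmorph_eq0 => /eqP. Qed.

Lemma abM a b : ab (a * b) = ab a * ab b.
Proof. by rewrite /ab rmorphM Normc.normcM. Qed.

Lemma ab_ofR r : ab (ofR r) = `|r|.
Proof. by rewrite /ab he_ofRE /= expr0n /= addr0 sqrtr_sqr. Qed.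

Lemma ab_cj a : ab (cj a) = ab a.
Proof. by rewrite /ab he_conjE; case: (iota a) => x y /=; rewrite sqrrN. Qed.

Lemma re_le_ab a : re a <= ab a.
Proof.
rewrite /ab /re; case: (iota a) => x y /=.
by rewrite (le_trans (ler_norm _)) // -sqrtr_sqr ler_wsqrtr // lerDl sqr_ge0.
Qed.

Lemma mul_cj a : a * cj a = ofR (ab a ^+ 2).
Proof.
apply: (fmorph_inj iota); rewrite he_ofRE rmorphM he_conjE -sqr_normc /ab.
by rewrite rmorphXn.
Qed.

Lemma re_sum I (r : seq I) (P : pred I) (F : I -> K) :
  re (\sum_(i <- r | P i) F i) = \sum_(i <- r | P i) re (F i).
Proof. exact: (big_morph re re_is_additive re0). Qed.

Lemma adjK m n (A : 'M[K]_(m, n)) : A ^h ^h = A.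
Proof. by apply/matrixP => i j; rewrite !mxE cjK. Qed.

Lemma adj_mul m n p (A : 'M[K]_(m, n)) (B : 'M[K]_(n, p)) :
  (A *m B)^h = B^h *m A^h.
Proof. by rewrite trmx_mul map_mxM. Qed.

Lemma adjD m n (A B : 'M[K]_(m, n)) : (A + B)^h = A^h + B^h.
Proof. by apply/matrixP => i j; rewrite !mxE rmorphD. Qed.

Lemma adjZ m n a (A : 'M[K]_(m, n)) : (a *: A)^h = cj a *: A^h.
Proof. by apply/matrixP => i j; rewrite !mxE rmorphM. Qed.

Lemma adj_inv n (A : 'M[K]_n) : (invmx A)^h = invmx (A^h).
Proof. by rewrite trmx_inv map_invmx. Qed.

Lemma adj_unit n (A : 'M[K]_n) : (A^h \in unitmx) = (A \in unitmx).
Proof. by rewrite map_unitmx unitmx_tr. Qed.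

(** Real parts put [qf] and [dt] in the ordered field [R] for either ground field; for Hermitian [P]
    they lose nothing, by [sesq_self] and [dt_real]. *)
Definition sesq n (P : 'M[K]_n) (u v : 'rV_n) : K := (u *m P *m v^h) 0 0.
Definition qf n (P : 'M[K]_n) (u : 'rV_n) : R := re (sesq P u u).
Definition dt n (P : 'M[K]_n) : R := re (\det P).

Section Sesq.
Variable n : nat.
Implicit Types (P Q A : 'M[K]_n) (u v w : 'rV[K]_n).

Lemma sesqDl P u v w : sesq P (u + v) w = sesq P u w + sesq P v w.
Proof. by rewrite /sesq !mulmxDl mxE. Qed.

Lemma sesqZl P a u w : sesq P (a *: u) w = a * sesq P u w.
Proof. by rewrite /sesq -!scalemxAl mxE. Qed.

Lemma sesqC P u v : P^h = P -> sesq P v u = cj (sesq P u v).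
Proof.
move=> hP; rewrite /sesq.
have -> : cj ((u *m P *m v^h) 0 0) = ((u *m P *m v^h)^h) 0 0 by rewrite !mxE.
by rewrite !adj_mul adjK hP mulmxA.
Qed.

Lemma sesqDr P u v w : sesq P w (u + v) = sesq P w u + sesq P w v.
Proof. by rewrite /sesq adjD mulmxDr mxE. Qed.

Lemma sesqZr P a u w : sesq P w (a *: u) = cj a * sesq P w u.
Proof. by rewrite /sesq adjZ -scalemxAr mxE. Qed.

Lemma sesq_self P u : P^h = P -> sesq P u u = ofR (qf P u).
Proof. by move=> hP; rewrite /qf ofR_re // -sesqC. Qed.

Lemma sesq_mul P A u v : sesq (A *m P *m A^h) u v = sesq P (u *m A) (v *m A).
Proof. by rewrite /sesq adj_mul !mulmxA. Qed.

Lemma qf_mul P A u : qf (A *m P *m A^h) u = qf P (u *m A).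
Proof. by rewrite /qf sesq_mul. Qed.

Lemma qfD P Q u : qf (P + Q) u = qf P u + qf Q u.
Proof. by rewrite /qf /sesq mulmxDr mulmxDl mxE re_is_additive. Qed.

Lemma qfZ r P u : qf (ofR r *: P) u = r * qf P u.
Proof. by rewrite /qf /sesq -scalemxAr -scalemxAl mxE re_ofRM. Qed.

Lemma qf0 P : qf P 0 = 0.
Proof. by rewrite /qf /sesq !mul0mx mxE re0. Qed.

Lemma qf_scale P a u : P^h = P -> qf P (a *: u) = ab a ^+ 2 * qf P u.
Proof.
by move=> hP; rewrite /qf sesqZl sesqZr mulrA mul_cj re_ofRM.
Qed.

Lemma qf_rank1 v u : qf (v^h *m v) u = ab ((u *m v^h) 0 0) ^+ 2.
Proof.
rewrite /qf /sesq mulmxA -mulmxA (mx11_scalar (u *m v^h)) mul_scalar_mx mxE.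
have -> : v *m u^h = (u *m v^h)^h by rewrite adj_mul adjK.
by rewrite !mxE mul_cj re_ofR.
Qed.

Lemma dt_real P : P^h = P -> \det P = ofR (dt P).
Proof. by move=> hP; rewrite /dt ofR_re // -[in RHS]hP det_map_mx det_tr. Qed.

Lemma dt_mul P A : P^h = P -> dt (A *m P *m A^h) = ab (\det A) ^+ 2 * dt P.
Proof.
move=> hP; rewrite /dt !det_mulmx det_map_mx det_tr mulrAC mul_cj.
exact: re_ofRM.
Qed.

Lemma dt_scale r P : dt (ofR r *: P) = r ^+ n * dt P.
Proof.
rewrite /dt detZ.
have -> : ofR r ^+ n = ofR (r ^+ n).
  by elim: n => [|k IH]; rewrite ?expr0 ?ofR1 // !exprS ofRM IH.
exact: re_ofRM.
Qed.

Lemma dt_unit P : 0 < dt P -> P \in unitmx.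
Proof.
move=> dP; rewrite unitmxE unitfE; apply/eqP => d0.
by move: dP; rewrite /dt d0 re0 ltxx.
Qed.

Definition pd P := P^h = P /\ forall u, u != 0 -> 0 < qf P u.

Lemma pd_ge0 P u : pd P -> 0 <= qf P u.
Proof.
move=> [_ pP]; have [->|/pP/ltW //] := eqVneq u 0; by rewrite qf0.
Qed.

Lemma pd_inv P : P \in unitmx -> pd P -> pd (invmx P).
Proof.
move=> Pu [hP pP]; split; first by rewrite adj_inv hP.
move=> u u0; have -> : invmx P = invmx P *m P *m (invmx P)^h.
  by rewrite adj_inv hP mulVmx // mul1mx.
rewrite qf_mul; apply: pP; apply: contra_neq u0 => /(congr1 (mulmx^~ P)).
by rewrite mulmxKV // mul0mx.
Qed.

Lemma sesq_CauchySchwarz P u v : pd P -> ab (sesq P u v) ^+ 2 <= qf P u * qf P v.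
Proof.
move=> pP; have hP := pP.1.
have [->|v0] := eqVneq v 0.
  by rewrite qf0 mulr0 /sesq trmx0 map_mx0 mulmx0 mxE ab0 expr0n.
have qv := pP.2 _ v0.
(* [w] is [qf P v] times the component of [u] orthogonal to [v]; the inequality is the nonnegativity
   of its form. *)
set s := sesq P u v; set w := ofR (qf P v) *: u + (- s) *: v.
have ew : sesq P w w = ofR (qf P v * (qf P u * qf P v - ab s ^+ 2)).
  rewrite /w !(sesqDl, sesqDr, sesqZl, sesqZr) cj_ofR rmorphN /=.
  rewrite (sesqC u v hP) (sesq_self u hP) (sesq_self v hP) -/s ofRM.
  have -> : ofR (qf P u * qf P v - ab s ^+ 2) =
      ofR (qf P u) * ofR (qf P v) - s * cj s.
    by apply/eqP; rewrite -subr_eq opprK mul_cj -ofRD subrK ofRM.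
  ring.
have := pd_ge0 w pP; rewrite {1}/qf ew re_ofR.
by rewrite pmulr_rge0 // subr_ge0.
Qed.

Lemma sqrt_qfD P u v : pd P ->
  Num.sqrt (qf P (u + v)) <= Num.sqrt (qf P u) + Num.sqrt (qf P v).
Proof.
move=> pP; have hP := pP.1.
have a0 := pd_ge0 u pP; have b0 := pd_ge0 v pP.
rewrite -ler_sqr ?nnegrE ?addr_ge0 ?sqrtr_ge0 // sqr_sqrtr ?pd_ge0 //.
rewrite sqrrD !sqr_sqrtr // /qf sesqDl !sesqDr !re_is_additive (sesqC u v hP) re_cj.
rewrite -/(qf P u) -/(qf P v).
have : re (sesq P u v) <= Num.sqrt (qf P u) * Num.sqrt (qf P v).
  apply: le_trans (re_le_ab _) _; rewrite -sqrtrM //.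
  rewrite -[leLHS]ger0_norm ?ab_ge0 // -sqrtr_sqr ler_wsqrtr //.
  exact: sesq_CauchySchwarz.
by lra.
Qed.

End Sesq.

(** The matrix determinant lemma: the same block matrix is factored with the unipotent [L] on the
    left and with [L] on the right, leaving two block triangular factors of equal determinant. *)
Lemma det_rank1 n (u v : 'rV[K]_n) :
  \det (1%:M + u^T *m v) = 1 + (v *m u^T) 0 0.
Proof.
pose L := block_mx (1%:M : 'M[K]_1) 0 (- u^T) (1%:M : 'M[K]_n).
have e1 : L *m block_mx 1%:M v 0 (1%:M + u^T *m v) = block_mx 1%:M v (- u^T) 1%:M.
  rewrite mulmx_block !(mul0mx, mulmx0, mul1mx, mulmx1, addr0).
  by rewrite mulNmx addrC addrK.
have e2 : block_mx (1%:M + v *m u^T) v 0 1%:M *m L = block_mx 1%:M v (- u^T) 1%:M.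
  rewrite mulmx_block !(mul0mx, mulmx0, mul1mx, mulmx1, addr0, add0r).
  by rewrite mulmxN addrK.
have detL : \det L = 1 by rewrite det_lblock !det1 mulr1.
have := congr1 determinant e1; rewrite -e2 !det_mulmx detL mulr1 mul1r !det_ublock.
by rewrite !det1 mul1r mulr1 => ->; rewrite [X in \det X]mx11_scalar det_scalar1 !mxE eqxx.
Qed.

Lemma bernoulli_le n (r : R) : 0 <= r <= 1 -> 1 - n%:R * r <= (1 - r) ^+ n.
Proof.
move=> /andP[r0 r1]; elim: n => [|n IH]; first by rewrite mul0r subr0 expr0.
rewrite exprS; apply: le_trans (_ : (1 - r) * (1 - n%:R * r) <= _); last first.
  by rewrite ler_wpM2l // subr_ge0.
have := ler0n R n; rewrite -natr1; nra.
Qed.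

(** At [r = 0] the left side is 1 and has derivative [q - n], which therefore cannot be positive.
    Bernoulli's inequality replaces the derivative. *)
Lemma le_nat_of_pow_le n (q : R) :
  (forall r, 0 < r < 1 -> (1 - r) ^+ n * (1 + r / (1 - r) * q) <= 1) -> q <= n%:R.
Proof.
move=> h; rewrite leNgt; apply/negP => qn; have n0 := ler0n R n.
set m := n%:R in qn n0 *.
have D0 : 0 < m * q + q + 1 by nra.
(* After Bernoulli the hypothesis amounts to [q - m <= m * r * (q - 1)]. The denominator exceeds
   [m * (q - 1)], so this [r] violates it, and exceeds [q - m], so [r < 1]. *)
pose r := (q - m) / (m * q + q + 1).
have er : r * (m * q + q + 1) = q - m by rewrite /r mulfVK // gt_eqF.
have r0 : 0 < r by rewrite divr_gt0 // subr_gt0.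
have r1 : r < 1 by rewrite /r ltr_pdivrMr // mul1r; nra.
have b : 1 - m * r <= (1 - r) ^+ n by apply: bernoulli_le; rewrite !ltW.
have := h r; rewrite r0 r1 => /(_ isT).
have s0 : 0 < 1 - r by rewrite subr_gt0.
rewrite -(ler_pM2r s0) mul1r -[leLHS]mulrA.
have -> : (1 + r / (1 - r) * q) * (1 - r) = 1 - r + r * q.
  by field; rewrite gt_eqF.
have p0 : 0 <= 1 - r + r * q by nra.
move=> /(le_trans (ler_wpM2r p0 b)).
have mr : m * r * (q - 1) < q - m.
  rewrite -er; nra.
nra.
Qed.

(** * Ellipsoids inside the unit ball of a norm, and John's theorem *)

Section Ellipsoids.
Variable n : nat.
Implicit Types (N : 'rV[K]_n -> R) (P Q G : 'M[K]_n) (u v : 'rV[K]_n).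

Definition is_norm N :=
  [/\ forall u, N u = 0 -> u = 0, forall a u, N (a *: u) = ab a * N u &
      forall u v, N (u + v) <= N u + N v].

Lemma is_norm0 N : is_norm N -> N 0 = 0.
Proof. by move=> [_ NZ _]; rewrite -(scale0r 0) NZ ab0 mul0r. Qed.

Lemma is_normN N u : is_norm N -> N (- u) = N u.
Proof.
move=> [_ NZ _]; rewrite -scaleN1r NZ /ab rmorphN rmorph1.
by rewrite normcN Normc.normc1 mul1r.
Qed.

Lemma is_norm_ge0 N u : is_norm N -> 0 <= N u.
Proof.
move=> nN; have [_ _ /(_ u (- u))] := nN.
by rewrite subrr is_norm0 // is_normN //; lra.
Qed.

(* For invertible [P] this says that the ellipsoid [qf (invmx P) <= 1] lies in
   the unit ball of [N]. *)
Definition feasible N P := P ^h = P /\ forall u, N (u *m P) ^+ 2 <= qf P u.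

(** The volume of the ellipsoid grows with [dt P], so [P] encodes an inscribed ellipsoid of maximal
    volume. The condition [0 < dt P] makes it nondegenerate. *)
Definition john N P :=
  [/\ feasible N P, 0 < dt P & forall Q, feasible N Q -> dt Q <= dt P].

Lemma feasible_convex N P Q r : is_norm N -> feasible N P -> feasible N Q ->
  0 <= r <= 1 -> feasible N (ofR (1 - r) *: P + ofR r *: Q).
Proof.
move=> nN [hP NP] [hQ NQ] /andP[r0 r1]; split.
  by rewrite adjD !adjZ !cj_ofR hP hQ.
move=> u; rewrite qfD !qfZ mulmxDr -!scalemxAr.
have [_ NZ ND] := nN; have := ND (ofR (1 - r) *: (u *m P)) (ofR r *: (u *m Q)).
rewrite !NZ !ab_ofR !ger0_norm ?subr_ge0 // => h.
have x0 := is_norm_ge0 (u *m P) nN; have y0 := is_norm_ge0 (u *m Q) nN.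
set z := N (_ + _) in h *; have z0 : 0 <= z by exact: is_norm_ge0.
have := NP u; have := NQ u.
move: (N (u *m P)) (N (u *m Q)) x0 y0 h => x y x0 y0 h yb xa.
have zz : z ^+ 2 <= ((1 - r) * x + r * y) ^+ 2.
  by rewrite ler_sqr // nnegrE addr_ge0 // mulr_ge0 // subr_ge0.
have e : ((1 - r) * x + r * y) ^+ 2 =
    (1 - r) * x ^+ 2 + r * y ^+ 2 - r * (1 - r) * (x - y) ^+ 2 by ring.
have p : 0 <= r * (1 - r) * (x - y) ^+ 2.
  by rewrite mulr_ge0 ?sqr_ge0 // mulr_ge0 // subr_ge0.
have h1 : (1 - r) * x ^+ 2 <= (1 - r) * qf P u by rewrite ler_wpM2l // subr_ge0.
have h2 : r * y ^+ 2 <= r * qf Q u by rewrite ler_wpM2l.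
lra.
Qed.

(** The matrix sends [u] to the multiple of [v] by the scalar [u *m v ^h], and its form at [u] is
    the squared modulus of that scalar. *)
Lemma feasible_rank1 N v : is_norm N -> N v <= 1 -> feasible N (v ^h *m v).
Proof.
move=> nN Nv; split; first by rewrite adj_mul adjK.
move=> u; rewrite qf_rank1 mulmxA {1}[u *m _]mx11_scalar mul_scalar_mx.
have [_ -> _] := nN; rewrite ler_sqr ?nnegrE ?mulr_ge0 ?ab_ge0 ?is_norm_ge0 //.
by rewrite ler_piMr // ab_ge0.
Qed.

Lemma feasible_pd N P : is_norm N -> feasible N P -> P \in unitmx -> pd P.
Proof.
move=> nN [hP NP] Pu; split => // u u0; apply: lt_le_trans (NP u).
rewrite exprn_gt0 // lt_def is_norm_ge0 // andbT.
have [Ndef _ _] := nN; apply: contra_neq u0 => /Ndef/(congr1 (mulmx^~ (invmx P))).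
by rewrite mulmxK // mul0mx.
Qed.

Lemma john_unit N P : john N P -> P \in unitmx.
Proof. by case=> _ /dt_unit. Qed.

Lemma john_pd N P : is_norm N -> john N P -> pd P.
Proof. by move=> nN jP; have [fP dP _] := jP; exact: feasible_pd nN fP (john_unit jP). Qed.

Lemma john_pd_inv N P : is_norm N -> john N P -> pd (invmx P).
Proof. by move=> nN jP; apply: pd_inv (john_unit jP) (john_pd nN jP). Qed.

(** This is feasibility evaluated at [v *m invmx P]. *)
Lemma john_lower N P v : is_norm N -> john N P -> N v ^+ 2 <= qf (invmx P) v.
Proof.
move=> nN jP; have [[hP NP] _ _] := jP; have Pu := john_unit jP.
have := NP (v *m invmx P); rewrite mulmxKV // => /le_trans; apply.
rewrite -qf_mul mulVmx // mul1mx adj_inv hP //.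
Qed.

(* Mixing the rank-one form [v ^h *m v] into [P] must not increase the determinant. *)
Lemma john_upper1 N P v : is_norm N -> john N P -> N v <= 1 ->
  qf (invmx P) v <= n%:R.
Proof.
move=> nN jP Nv; have [fP dP maxP] := jP; have Pu := john_unit jP.
have hPi : (invmx P) ^h = invmx P by rewrite adj_inv fP.1.
apply: le_nat_of_pow_le => r /andP[r0 r1].
have s0 : 0 < 1 - r by rewrite subr_gt0.
have r01 : 0 <= r <= 1 by rewrite !ltW.
have := maxP _ (feasible_convex nN fP (feasible_rank1 nN Nv) r01).
(* Factoring out [P] leaves a rank-one perturbation of the identity, whose determinant is
   [1 + r / (1 - r) * qf (invmx P) v] by [det_rank1]. *)
have -> : ofR (1 - r) *: P + ofR r *: (v ^h *m v) =
    ofR (1 - r) *: (P *m (1%:M + ((v *m invmx P) ^h) *m (ofR (r / (1 - r)) *: v))).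
  rewrite mulmxDr mulmx1 scalerDr; congr (_ + _).
  rewrite adj_mul hPi mulmxA mulKVmx // -scalemxAr scalerA -ofRM.
  by rewrite mulrCA mulfV ?mulr1 // gt_eqF.
rewrite dt_scale {1}/dt det_mulmx (dt_real fP.1) re_ofRM.
rewrite -map_trmx det_rank1 map_trmx -scalemxAl mxE.
have -> : (v *m (v *m invmx P)^h) 0 0 = ofR (qf (invmx P) v).
  by rewrite -(sesq_self _ hPi) adj_mul hPi mulmxA.
rewrite -ofRM re_is_additive !re_ofR -{1}ofR1 re_ofR mulrCA -[leRHS]mulr1 ler_pM2l //.
Qed.

Lemma john_upper N P v : is_norm N -> john N P ->
  qf (invmx P) v <= n%:R * N v ^+ 2.
Proof.
move=> nN jP; have [->|v0] := eqVneq v 0.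
  by rewrite qf0 mulr_ge0 ?sqr_ge0 // ler0n.
have [Ndef NZ _] := nN.
have Nv : 0 < N v.
  by rewrite lt_def is_norm_ge0 // andbT; apply: contra_neq v0 => /Ndef.
have hP := (john_pd_inv nN jP).1.
have := @john_upper1 N P (ofR (N v)^-1 *: v) nN jP.
have NV0 : 0 <= (N v)^-1 by rewrite invr_ge0 ltW.
rewrite NZ qf_scale // ab_ofR ger0_norm // mulVf ?gt_eqF // => /(_ (lexx _)).
by rewrite exprVn ler_pdivrMl ?exprn_gt0 // mulrC.
Qed.

Lemma feasible_change N N' G P : G \in unitmx -> (forall u, N' u = N (u *m G)) ->
  feasible N P -> feasible N' ((invmx G) ^h *m P *m invmx G).
Proof.
move=> Gu eN [hP NP]; split; first by rewrite !adj_mul adjK hP mulmxA.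
move=> u; rewrite -{4}[invmx G]adjK qf_mul eN !mulmxA mulmxKV //; exact: NP.
Qed.

Lemma dt_change G P : P ^h = P ->
  dt ((invmx G) ^h *m P *m invmx G) = ab (\det (invmx G)) ^+ 2 * dt P.
Proof.
by move=> hP; rewrite -{2}[invmx G]adjK dt_mul // det_map_mx det_tr ab_cj.
Qed.

(** A change of basis carries feasible matrices to feasible matrices in both directions and
    multiplies all their determinants by one positive factor. This allows the maximal ellipsoid of a
    fiber to be read in any basis of it. *)
Lemma john_change N N' G P : G \in unitmx -> (forall u, N' u = N (u *m G)) ->
  john N P -> john N' ((invmx G) ^h *m P *m invmx G).
Proof.
move=> Gu eN [fP dP maxP].
have Giu : invmx G \in unitmx by rewrite unitmx_inv.
have dG : 0 < ab (\det (invmx G)) ^+ 2.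
  rewrite exprn_gt0 // lt_def ab_ge0 andbT; apply/eqP => /ab_eq0/eqP.
  by apply/negP; rewrite -unitfE -unitmxE.
split; first exact: feasible_change fP.
- by rewrite dt_change ?fP.1 // mulr_gt0.
- move=> Q fQ.
  have [Q' fQ' ->] : exists2 Q', feasible N Q' & Q = (invmx G) ^h *m Q' *m invmx G.
    exists ((invmx (invmx G)) ^h *m Q *m invmx (invmx G)).
      by apply: feasible_change fQ => // u; rewrite eN mulmxKV.
    by rewrite invmxK !mulmxA -adj_mul mulmxV // trmx1 map_mx1 mul1mx mulmxK.
  by rewrite !dt_change ?fP.1 ?fQ'.1 // ler_pM2l //; exact: maxP.
Qed.

Lemma qf_inv_change G P u : G \in unitmx -> P \in unitmx ->
  qf (invmx ((invmx G) ^h *m P *m invmx G)) u = qf (invmx P) (u *m G).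
Proof.
move=> Gu Pu; rewrite !invmx_mul ?unitmx_mul ?adj_unit ?unitmx_inv ?Gu ?Pu // invmxK.
by rewrite adj_inv invmxK mulmxA qf_mul.
Qed.

End Ellipsoids.

End Forms.

(** * Stability of the maximal ellipsoid under perturbation of the norm *)

Section Stability.
Variables (R : realType) (K : numFieldType) (H : hermitian_embedding R K).
Local Notation iota := (he_iota H).
Local Notation "M ^h" := (M ^t (he_conj H)) (at level 30).

Lemma map_iota_adj m n (A : 'M[K]_(m, n)) :
  (map_mx iota A) ^t* = map_mx iota (A ^h).
Proof. by apply/matrixP => i j; rewrite !mxE he_conjE. Qed.

Lemma map_iota_sesq n (P : 'M[K]_n) (u v : 'rV_n) :
  (map_mx iota u *m map_mx iota P *m (map_mx iota v) ^t*) 0 0 = iota (sesq H P u v).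
Proof. by rewrite map_iota_adj -!map_mxM mxE. Qed.

(** Transfers positivity to [R[i]], where the spectral argument takes place. Over the reals this
    requires positivity on complex vectors, which are more numerous than the given ones. *)
Lemma posdefmx_map n (P : 'M[K]_n) : pd H P -> posdefmx (map_mx iota P).
Proof.
move=> pP; have hP := pP.1; split; first by rewrite map_iota_adj hP.
move=> u u0.
have sesq_qf w : iota (sesq H P w w) = (qf H P w)%:C%C.
  by rewrite (sesq_self w hP) he_ofRE.
have [cj_id|iota_surj] := he_cases H; last first.
  have [w eu] : exists w, u = map_mx iota w.
    exists (\row_j sval (cid (iota_surj (u 0 j)))).
    by apply/rowP => j; rewrite !mxE; case: cid.
  rewrite eu map_iota_sesq sesq_qf ltcR; apply: pP.2.
  by apply: contra_neq u0 => w0; rewrite eu w0 map_mx0.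
(* [u = x + i y] with [x], [y] real; the cross terms cancel by symmetry *)
pose x : 'rV[K]_n := \row_j he_ofR H (complex.Re (u 0 j)).
pose y : 'rV[K]_n := \row_j he_ofR H (complex.Im (u 0 j)).
have eu : u = map_mx iota x + 'i%C *: map_mx iota y.
  by apply/rowP => j; rewrite !mxE !he_ofRE -complexE.
have sC : sesq H P y x = sesq H P x y by rewrite (sesqC x y hP) cj_id.
pose F (v w : 'rV[R[i]]_n) := (v *m map_mx iota P *m w ^t*) 0 0.
have FDl v v' w : F (v + v') w = F v w + F v' w by rewrite /F !mulmxDl mxE.
have FZl c v w : F (c *: v) w = c * F v w by rewrite /F -!scalemxAl mxE.
have FDr v w w' : F v (w + w') = F v w + F v w'.
  by rewrite /F linearD /= map_mxD mulmxDr mxE.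
have FZr c v w : F v (c *: w) = c^*%C * F v w.
  by rewrite /F linearZ /= map_mxZ -scalemxAr mxE.
have FE v w : F (map_mx iota v) (map_mx iota w) = iota (sesq H P v w).
  exact: map_iota_sesq.
have -> : (u *m map_mx iota P *m u^t*) 0 0 = (qf H P x + qf H P y)%:C%C.
  rewrite -/(F u u) eu !(FDl, FDr, FZl, FZr) !FE sC !sesq_qf rmorphD.
  have -> : ('i%C)^*%C = - 'i%C :> R[i] by apply/eqP; rewrite eq_complex /= oppr0 !eqxx.
  set z := iota _; have i2 := @sqr_i R; set q := (qf H P y)%:C%C.
  by transitivity ((qf H P x)%:C%C - 'i%C ^+ 2 * q); [ring | rewrite i2; ring].
rewrite ltcR; have [x0|x0] := eqVneq x 0; last first.
  by rewrite ltr_pwDl ?pP.2 // pd_ge0.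
rewrite x0 qf0 add0r pP.2 //; apply: contra_neq u0 => y0.
by rewrite eu x0 y0 !map_mx0 scaler0 addr0.
Qed.

(** Shrinking [P] by [t ^- 2] gives a competitor [A] for [N']. The midpoint of [A] and [P'] is
    feasible for [N'], so its determinant is at most that of the maximiser [P'], while the
    determinant of [A] is nearly that of [P']; [posdefmx_inv_form_le] then compares the inverse
    forms. *)
Lemma john_stable n N N' (P P' : 'M[K]_n) (t d : R) : is_norm H N -> is_norm H N' ->
  john H N P -> john H N' P' -> (forall u, N u <= t * N' u) ->
  (forall u, N' u <= t * N u) -> 1 <= t -> 0 < d ->
  t ^+ (4 * n) <= 1 + d ^+ 2 / (4 * (1 + d)) ->
  forall u, qf H (invmx P) u <= (1 + d) * qf H (invmx P') u.
Proof.
move=> nN nN' jP jP' NN' N'N t1 d0 t_le u.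
have t0 : 0 < t by apply: lt_le_trans t1.
have [fP dP maxP] := jP; have [fP' dP' maxP'] := jP'.
have feasible_scale (M M' : 'rV[K]_n -> R) Q : is_norm H M' -> (forall v, M' v <= t * M v) ->
    feasible H M Q -> feasible H M' (he_ofR H (t ^- 2) *: Q).
  move=> nM' MM' [hQ MQ]; split; first by rewrite adjZ cj_ofR hQ.
  move=> v; rewrite qfZ -scalemxAr; have [_ -> _] := nM'.
  have s0 : 0 < t ^- 2 by rewrite invr_gt0 exprn_gt0.
  rewrite ab_ofR gtr0_norm // exprMn [t ^- 2 ^+ 2]expr2 -mulrA ler_pM2l //.
  rewrite ler_pdivrMl ?exprn_gt0 //.
  apply: le_trans (_ : (t * M (v *m Q)) ^+ 2 <= _).
    have := is_norm_ge0 (v *m Q) nM'; have := MM' (v *m Q).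
    by move=> h1 h2; rewrite ler_sqr ?nnegrE // (le_trans h2).
  by rewrite exprMn ler_pM2l ?exprn_gt0.
set A := he_ofR H (t ^- 2) *: P.
have fA : feasible H N' A by exact: feasible_scale fP.
have dA : dt H A = (t ^- 2) ^+ n * dt H P by exact: dt_scale.
have tn0 : 0 < (t ^- 2) ^+ n by rewrite exprn_gt0 // invr_gt0 exprn_gt0.
have dA0 : 0 < dt H A by rewrite dA mulr_gt0.
have Au := dt_unit dA0; have pdA := feasible_pd nN' fA Au.
have pdP' := john_pd nN' jP'.
have P'u := john_unit jP'.
have hAP' : (A + P') ^h = A + P' by rewrite adjD pdA.1 pdP'.1.
have mid : dt H (A + P') <= 2 ^+ n * dt H P'.
  have h01 : 0 <= (2^-1 : R) <= 1 by apply/andP; split; lra.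
  have := maxP' _ (feasible_convex nN' fA fP' h01).
  have -> : 1 - 2^-1 = 2^-1 :> R by field.
  rewrite -scalerDr dt_scale exprVn ler_pdivrMl ?exprn_gt0 //.
(* One factor [t ^+ (2 * n)] comes from shrinking [P'] into a competitor of [P] for [N], the other
   from passing from [P] to [A]. *)
have le_dA : dt H P' <= t ^+ (4 * n) * dt H A.
  have := maxP _ (feasible_scale N' N P' nN NN' fP'); rewrite dt_scale => h.
  rewrite dA mulrA; apply: le_trans (_ : t ^+ (2 * n) * dt H P <= _).
    move: h; rewrite exprVn -exprM ler_pdivrMl ?exprn_gt0 //.
  rewrite ler_pM2r // exprVn -exprM -expfB_cond ?ler_weXn2l //.
    by rewrite -mulnBl.
  by rewrite gt_eqF //= leq_mul.
have := @posdefmx_inv_form_le _ _ _ _ (t ^+ (4 * n)) d (posdefmx_map pdA)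
   (posdefmx_map pdP') _ _ d0 t_le (map_mx iota u).
rewrite -map_mxD !det_map_mx (dt_real hAP') (dt_real pdA.1) (dt_real pdP'.1).
rewrite !he_ofRE -!map_invmx !map_iota_sesq.
rewrite -(rmorph_nat (real_complex R)) -rmorphXn -!rmorphM /= !lecR => /(_ mid le_dA).
have hPi : (invmx P) ^h = invmx P by rewrite adj_inv fP.1.
have hP'i : (invmx P') ^h = invmx P' by rewrite adj_inv fP'.1.
have hAi : (invmx A) ^h = invmx A by rewrite adj_inv fA.1.
rewrite (sesq_self _ hAi) (sesq_self _ hP'i) !he_ofRE -rmorphM lecR.
apply: le_trans.
(* Since [1 <= t], the form of [invmx A] dominates that of [invmx P]. *)
have -> : invmx A = he_ofR H (t ^+ 2) *: invmx P.
  rewrite invmxZ //; congr (_ *: _); apply: (fmorph_inj iota).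
  by rewrite fmorphV !he_ofRE -fmorphV /= invrK.
rewrite qfZ ler_peMl ?exprn_ege1 //; exact: pd_ge0 (john_pd_inv nN jP).
Qed.

End Stability.

(** * Compactness and the existence of a maximal ellipsoid *)

Lemma continuous_mul (T : topologicalType) (K : numFieldType) (f g : T -> K) :
  continuous f -> continuous g -> continuous (fun x => f x * g x).
Proof. by move=> cf cg x; exact: (continuousM (cf x) (cg x)). Qed.

Lemma continuous_sub (T : topologicalType) (K : numFieldType) (f g : T -> K) :
  continuous f -> continuous g -> continuous (fun x => f x - g x).
Proof. by move=> cf cg x; exact: (continuousB (cf x) (cg x)). Qed.

Lemma continuous_compose (T U V : topologicalType) (f : T -> U) (g : U -> V) :
  continuous f -> continuous g -> continuous (fun x => g (f x)).
Proof. by move=> cf cg x; exact: continuous_comp (cf x) (cg (f x)). Qed.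

Lemma closed_preimage (T U : topologicalType) (f : T -> U) (D : set U) :
  continuous f -> closed D -> closed (f @^-1` D).
Proof. by move=> /continuous_closedP; exact. Qed.

Section Existence.
Variables (R : realType) (K : numFieldType) (H : hermitian_embedding R K).
Local Notation "M ^h" := (M ^t (he_conj H)) (at level 30).
Local Notation re := (re H).
Local Notation ab := (ab H).

Lemma ab_continuous : continuous ab. Proof. exact: he_continuous_abs. Qed.

Lemma re_continuous : continuous re. Proof. exact: he_continuous_Re. Qed.

(** A reference norm with values in [R] for both ground fields; every other norm is compared with it
    on its compact unit sphere. *)
Definition l1 n (u : 'rV[K]_n) : R := \sum_i ab (u 0 i).

Lemma l1_ge0 n (u : 'rV[K]_n) : 0 <= l1 u.
Proof. by apply: sumr_ge0 => i _; exact: ab_ge0. Qed.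

Lemma ab_le_l1 n (u : 'rV[K]_n) i : ab (u 0 i) <= l1 u.
Proof. by rewrite /l1 (bigD1 i) //= lerDl sumr_ge0 // => j _; exact: ab_ge0. Qed.

Lemma l1_eq0 n (u : 'rV[K]_n) : l1 u = 0 -> u = 0.
Proof.
move=> u0; apply/rowP => i; rewrite mxE; apply: (@ab_eq0 _ _ H).
by apply/eqP; rewrite eq_le ab_ge0 andbT -u0 ab_le_l1.
Qed.

Lemma l1Z n a (u : 'rV[K]_n) : l1 (a *: u) = ab a * l1 u.
Proof. by rewrite /l1 mulr_sumr; apply: eq_bigr => i _; rewrite mxE abM. Qed.

Lemma l1_continuous n : continuous (@l1 n).
Proof.
apply: continuous_big => [|i _]; first exact: add_continuous.
by move=> u; apply: continuous_comp; [exact: coord_continuous | exact: ab_continuous].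
Qed.

Lemma l1_sphere_compact n : compact [set u : 'rV[K]_n | l1 u = 1].
Proof.
have -> : [set u : 'rV[K]_n | l1 u = 1] =
    [set u : 'rV[K]_n | forall i, [set a | ab a <= 1] (u ord0 i)] `&` [set u | l1 u = 1].
  by apply/seteqP; split => u /= => [u1|[]//]; split => // i; rewrite -u1 ab_le_l1.
apply: compact_closedI.
  by apply: (@rV_compact _ _ (fun=> [set a | ab a <= 1])) => i; exact: he_compact.
rewrite (_ : [set u | _] = @l1 n @^-1` [set 1]); last by [].
apply: preimage_closed; first by move=> u _; exact: l1_continuous.
exact: closed_eq.
Qed.

Section Norms.
Variables (n : nat) (N : 'rV[K]_n -> R).
Hypothesis nN : is_norm H N.

Lemma is_norm_le_l1 : exists2 M, 0 <= M & forall u, N u <= M * l1 u.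
Proof.
have [_ NZ ND] := nN.
exists (\sum_i N (delta_mx 0 i)).
  by apply: sumr_ge0 => i _; exact: is_norm_ge0 nN.
move=> u; rewrite [in leLHS](row_sum_delta u) /l1 mulr_sumr.
apply: (@le_trans _ _ (\sum_i N (u 0 i *: delta_mx 0 i))).
  apply: (big_ind2 (fun x y => N x <= y)) => //; first by rewrite (is_norm0 nN).
  by move=> x x' y y' h1 h2; rewrite (le_trans (ND _ _)) // lerD.
apply: ler_sum => i _; rewrite NZ mulrC ler_wpM2r ?ab_ge0 //.
rewrite (bigD1 i) //= lerDl; apply: sumr_ge0 => j _; exact: is_norm_ge0 nN.
Qed.

Lemma is_norm_continuous : continuous N.
Proof.
have [_ _ ND] := nN; have [M M0 NM] := is_norm_le_l1.
move=> u; apply/(@cvgrPdist_le _ _ _ (nbhs u) (nbhs_filter u)) => e e0.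
have : continuous (fun v : 'rV[K]_n => M * l1 (u - v)).
  move=> v; apply: (@continuous_comp _ _ _ (fun v : 'rV[K]_n => l1 (u - v)) (fun x : R => M * x)).
    move: v; apply: continuous_big => [|i _]; first exact: add_continuous.
    move=> v; apply: (@continuous_comp _ _ _ (fun v : 'rV[K]_n => (u - v) 0 i) ab).
      rewrite (_ : (fun v : 'rV[K]_n => _) = (fun v => u 0 i - v 0 i)).
        by apply: continuousB; [exact: cst_continuous | exact: coord_continuous].
      by apply/funext => w; rewrite !mxE.
    exact: ab_continuous.
  exact: mulrl_continuous.
move=> /(_ u); rewrite /continuous_at.
rewrite subrr; have -> : l1 (0 : 'rV[K]_n) = 0.
  by rewrite -(scale0r 0) l1Z ab0 mul0r.
rewrite mulr0 => /(@cvgrPdist_le _ _ _ (nbhs u) (nbhs_filter u))/(_ _ e0).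
apply: filterS => v; rewrite sub0r normrN.
rewrite ger0_norm ?mulr_ge0 ?l1_ge0 // => h; apply: le_trans h.
have h1 := ND (u - v) v; have h2 := ND (v - u) u.
rewrite !subrK in h1 h2.
have h3 := NM (u - v).
have h4 : N (v - u) = N (u - v) by rewrite -opprB (is_normN _ nN).
by rewrite ler_norml; apply/andP; split; lra.
Qed.

Lemma is_norm_ge_l1 : exists2 m, 0 < m & forall u, m * l1 u <= N u.
Proof.
have [Ndef NZ _] := nN.
(* The sphere is empty exactly when [n = 0]; then [l1] vanishes and any constant serves. *)
have [S0|S0] := pselect ([set u : 'rV[K]_n | l1 u = 1] !=set0); last first.
  exists 1 => // u; have [->|u0] := eqVneq (l1 u) 0.
    by rewrite mulr0 (is_norm_ge0 _ nN).
  case: S0; exists (he_ofR H (l1 u)^-1 *: u) => /=.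
  by rewrite l1Z ab_ofR ger0_norm ?invr_ge0 ?l1_ge0 // mulVf.
have cN : {within [set u : 'rV[K]_n | l1 u = 1], continuous N}.
  by apply: continuous_subspaceT; exact: is_norm_continuous.
have [c] := compact_EVT_min S0 (@l1_sphere_compact n) cN.
rewrite inE /= => c1 cmin.
have Nc : 0 < N c.
  rewrite lt_def (is_norm_ge0 _ nN) andbT; apply/eqP => /Ndef c0.
  by move/eqP: c1; rewrite c0 -(scale0r 0) l1Z ab0 mul0r eq_sym oner_eq0.
exists (N c) => // u; have [->|u0] := eqVneq (l1 u) 0.
  by rewrite mulr0 (is_norm_ge0 _ nN).
have lu : 0 < l1 u by rewrite lt_def u0 l1_ge0.
have := cmin (he_ofR H (l1 u)^-1 *: u); rewrite inE /= l1Z NZ ab_ofR.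
rewrite ger0_norm ?invr_ge0 ?l1_ge0 // mulVf // => /(_ erefl).
by rewrite ler_pdivlMl // mulrC.
Qed.

Lemma feasible_scalar : exists2 c : R, 0 < c & feasible H N (he_ofR H c)%:M.
Proof.
have [M M0 NM] := is_norm_le_l1; have [_ NZ _] := nN.
(* [N u] is at most [M * n] times the Euclidean norm of [u], so feasibility of the scalar [1 / D]
   needs [M^2 * n^2 <= D]; the added 1 keeps [D] positive. *)
pose D := 1 + M ^+ 2 * n%:R ^+ 2.
have D0 : 0 < D by rewrite ltr_pwDl // mulr_ge0 // exprn_ge0.
exists D^-1; first by rewrite invr_gt0.
split.
  by rewrite tr_scalar_mx map_scalar_mx /= cj_ofR.
move=> u; rewrite mul_mx_scalar NZ ab_ofR gtr0_norm ?invr_gt0 //.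
have -> : (he_ofR H D^-1)%:M = he_ofR H D^-1 *: (1%:M : 'M[K]_n).
  by rewrite scalemx1.
rewrite qfZ exprMn [_ ^+ 2]expr2 -mulrA ler_pM2l ?invr_gt0 //.
rewrite ler_pdivrMl //.
have eq1 : qf H 1%:M u = \sum_i ab (u 0 i) ^+ 2.
  rewrite /qf /sesq mulmx1 mxE re_sum; apply: eq_bigr => i _.
  by rewrite !mxE mul_cj re_ofR.
have abq i : ab (u 0 i) ^+ 2 <= qf H 1%:M u.
  by rewrite eq1 (bigD1 i) //= lerDl sumr_ge0 // => j _; exact: sqr_ge0.
have q0 : 0 <= qf H 1%:M u by rewrite eq1 sumr_ge0 // => j _; exact: sqr_ge0.
have l1q : l1 u <= n%:R * Num.sqrt (qf H 1%:M u).
  rewrite -[n in n%:R]card_ord -sum1_card natr_sum mulr_suml; apply: ler_sum => i _.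
  by rewrite mul1r -[leLHS]ger0_norm ?ab_ge0 // -sqrtr_sqr ler_wsqrtr.
have Nu := NM u; have N0 := is_norm_ge0 u nN.
apply: le_trans (_ : (M * (n%:R * Num.sqrt (qf H 1%:M u))) ^+ 2 <= _).
  rewrite ler_sqr ?nnegrE ?mulr_ge0 ?sqrtr_ge0 //.
  by rewrite (le_trans Nu) // ler_wpM2l.
by rewrite !exprMn sqr_sqrtr // mulrA ler_wpM2r // lerDr.
Qed.

(** Feasibility at the standard basis vector [i] bounds the squared norm of row [i] by a diagonal
    entry, hence by the [l1] norm of that row. A quadratic quantity bounded by a linear one gives
    [l1 (row i P) <= m ^- 2]. *)
Lemma feasible_bounded : exists M, forall P i j, feasible H N P -> ab (P i j) <= M.
Proof.
have [m m0 Nm] := is_norm_ge_l1.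
exists (m ^- 2) => P i j [_ /(_ (delta_mx 0 i))]; rewrite -rowE => h.
have rP : l1 (row i P) <= m ^- 2.
  have := le_trans h (re_le_ab H _).
  have -> : sesq H P (delta_mx 0 i) (delta_mx 0 i) = row i P 0 i.
    rewrite /sesq -rowE mxE (bigD1 i) //= big1 => [|k ki]; rewrite !mxE.
      by rewrite !eqxx rmorph1 mulr1 addr0.
    by rewrite (negbTE ki) andbF rmorph0 mulr0.
  move=> /le_trans/(_ (ab_le_l1 _ _)) h2.
  have l0 := l1_ge0 (row i P); have := Nm (row i P).
  have [->|lP] := eqVneq (l1 (row i P)) 0.
    by move=> _; rewrite invr_ge0 exprn_ge0 // ltW.
  have {}lP : 0 < l1 (row i P) by rewrite lt_def lP.
  rewrite -[m ^- 2]mul1r ler_pdivlMr ?exprn_gt0 // => h3.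
  have h4 : (m * l1 (row i P)) ^+ 2 <= l1 (row i P).
    apply: le_trans h2; rewrite ler_sqr ?nnegrE ?(is_norm_ge0 _ nN) //.
    by rewrite mulr_ge0 // ltW.
  rewrite -(ler_pM2l lP) mulr1; apply: le_trans h4.
  by rewrite exprMn mulrCA mulrA -expr2 mulrC.
by apply: le_trans rP; have := ab_le_l1 (row i P) j; rewrite mxE.
Qed.

(** Matrices are read as row vectors of length [n * n], so that [rV_compact] applies to sets of
    matrices. *)
Local Notation mx v := (vec_mx v : 'M[K]_n).

Lemma vec_mx_entry_continuous i j :
  continuous (fun v : 'rV[K]_(n * n) => (mx v) i j).
Proof.
rewrite (_ : (fun v : 'rV[K]_(n * n) => _) = (fun v => v 0 (mxvec_index i j))); last first.
  by apply/funext => v; rewrite mxE.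
exact: coord_continuous.
Qed.

Lemma dt_vec_mx_continuous : continuous (fun v : 'rV[K]_(n * n) => dt H (mx v)).
Proof.
move=> v; apply: (@continuous_comp _ _ _ (fun v => \det (mx v)) re); last exact: re_continuous.
apply: continuous_big => [|s _]; first exact: add_continuous.
apply: continuous_mul; first exact: cst_continuous.
apply: continuous_big => [|i _]; first exact: mul_continuous.
exact: vec_mx_entry_continuous.
Qed.

Lemma feasible_closed : closed [set v : 'rV[K]_(n * n) | feasible H N (mx v)].
Proof.
have -> : [set v : 'rV[K]_(n * n) | feasible H N (mx v)] =
    (\bigcap_(ij in [set: 'I_n * 'I_n])
      (fun v => ab (he_conj H ((mx v) ij.2 ij.1) - (mx v) ij.1 ij.2)) @^-1` [set x | x <= 0])
    `&` \bigcap_(u in [set: 'rV[K]_n])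
      (fun v => qf H (mx v) u - N (u *m mx v) ^+ 2) @^-1` [set x | 0 <= x].
  apply/seteqP; split => v /=.
    move=> [hv Nv]; split => [[i j] _|u _] /=; last by rewrite subr_ge0.
    by rewrite -{2}hv !mxE subrr ab0.
  move=> [hv Nv]; split => [|u]; last by rewrite -subr_ge0; exact: Nv.
  apply/matrixP => i j; have /= h := hv (i, j) I.
  rewrite [LHS]mxE [in LHS]mxE; apply/eqP; rewrite -subr_eq0; apply/eqP.
  by apply: (@ab_eq0 _ _ H); apply/eqP; rewrite eq_le h ab_ge0.
apply: closedI.
  apply: closed_bigI => -[i j] _ /=; apply: closed_preimage; last exact: closed_le.
  apply: (continuous_compose (g := ab)); last exact: ab_continuous.
  apply: continuous_sub; last exact: vec_mx_entry_continuous.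
  apply: (continuous_compose (g := he_conj H)); last exact: he_continuous_conj.
  exact: vec_mx_entry_continuous.
apply: closed_bigI => u _ /=.
have cu k : continuous (fun v : 'rV[K]_(n * n) => (u *m mx v) 0 k).
  rewrite (_ : (fun v : 'rV[K]_(n * n) => _) = (fun v => \sum_i u 0 i * (mx v) i k)).
    apply: continuous_big => [|i _]; first exact: add_continuous.
    by apply: continuous_mul; [exact: cst_continuous | exact: vec_mx_entry_continuous].
  by apply/funext => v; rewrite mxE.
apply: closed_preimage; last exact: closed_ge.
apply: continuous_sub.
  apply: (continuous_compose (g := re)); last exact: re_continuous.
  rewrite (_ : (fun v : 'rV[K]_(n * n) => _) =
      (fun v => \sum_i (u *m mx v) 0 i * (u ^h) i 0)).
    apply: continuous_big => [|i _]; first exact: add_continuous.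
    by apply: continuous_mul; [exact: cu | exact: cst_continuous].
  by apply/funext => w; rewrite /sesq mxE.
apply: (continuous_compose (g := fun x : R => x ^+ 2)); last exact: exprn_continuous.
apply: (continuous_compose (g := N)); last exact: is_norm_continuous.
move=> v A [B nB BA].
have : \forall v' \near v, forall k, B 0 k ((u *m mx v') 0 k).
  by apply: (@filter_forall _ _ _ (nbhs v) (nbhs_filter v)) => k; exact: cu (nB _ _).
by apply: (@filterS _ (nbhs v) (nbhs_filter v)) => v' Bv'; apply: BA => i k; rewrite ord1.
Qed.

(** The feasible set is closed and bounded, so the determinant attains its maximum; comparison with
    a feasible positive scalar matrix makes this maximum positive. *)
Lemma john_exists : exists P, john H N P.
Proof.
have [M leM] := feasible_bounded; have [c c0 fc] := feasible_scalar.
pose F := [set v : 'rV[K]_(n * n) | feasible H N (mx v)].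
have cF : compact F.
  apply: (@subclosed_compact _ _ [set v : 'rV[K]_(n * n) | forall k, [set a | ab a <= M] (v ord0 k)]).
  - exact: feasible_closed.
  - by apply: (@rV_compact _ _ (fun=> [set a | ab a <= M])) => k; exact: he_compact.
  - move=> v /= fv k; case: (mxvec_indexP k) => i j.
    by have := leM _ i j fv; rewrite mxE.
have F0 : F !=set0 by exists (mxvec (he_ofR H c)%:M); rewrite /F /= mxvecK.
have cdt : {within F, continuous (fun v => dt H (mx v))}.
  by apply: continuous_subspaceT; exact: dt_vec_mx_continuous.
have [v] := compact_EVT_max F0 cF cdt; rewrite inE => Fv vmax.
have maxv Q : feasible H N Q -> dt H Q <= dt H (mx v).
  by move=> fQ; have := vmax (mxvec Q); rewrite inE /F /= mxvecK; exact.
exists (mx v); split => //; apply: lt_le_trans (maxv _ fc).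
have -> : (he_ofR H c)%:M = he_ofR H c *: (1%:M : 'M[K]_n) by rewrite scalemx1.
by rewrite dt_scale /dt det1 -(ofR1 H) re_ofR mulr1 exprn_gt0.
Qed.

End Norms.
End Existence.

(** * The real and the complex ground field as instances of [hermitian_embedding] *)

Section Instances.
Variable R : realType.

Lemma real_normc_continuous :
  continuous (fun a : (R : numFieldType) => Normc.normc (real_complex R a)).
Proof.
rewrite (_ : (fun a : (R : numFieldType) => _) = (fun a : R => `|a|)).
  exact: norm_continuous.
by apply/funext => a /=; rewrite expr0n /= addr0 sqrtr_sqr.
Qed.

Lemma real_ball_compact (M : R) :
  compact [set a : (R : numFieldType) | Normc.normc (real_complex R a) <= M].
Proof.
rewrite (_ : [set a | _] = `[- M, M]%classic); first exact: segment_compact.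
apply/seteqP; split => a /=; rewrite in_itv /= expr0n /= addr0 sqrtr_sqr ler_norml //.
Qed.

Definition real_embedding : hermitian_embedding R R :=
  @HermitianEmbedding R R idfun (real_complex R) id
    (fun a => esym (conjc_real a)) (fun=> erefl) (or_introl (fun=> erefl))
    (fun x => cvg_id) (fun x => cvg_id) real_normc_continuous real_ball_compact.

Local Notation C := (R[i] : numFieldType).

(** Balls of [R[i]] have radii in [R[i]], but a positive element of [R[i]] has zero imaginary part,
    so real radii describe the same neighbourhoods. *)
Lemma complex_nbhsP (z : C) (A : set C) :
  nbhs z A <-> exists2 e : R, 0 < e & forall w : C, Normc.normc (z - w) < e -> A w.
Proof.
split.
  move=> /nbhs_ballP[e e0 zA]; have := e0; rewrite /= ltcE => /andP[/= Ie Re0].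
  exists (complex.Re e) => // w zw; apply: zA; rewrite /ball /= normc_def.
  by rewrite ltcE /= (eqP Ie) eqxx; case: (z - w) zw.
move=> [e e0 zA]; apply/nbhs_ballP; exists (e%:C)%C; first by rewrite /= ltcR.
by move=> w; rewrite /ball /= normc_def ltcR => zw; apply: zA; case: (z - w) zw.
Qed.

Lemma complex_lipschitz_continuous (f : C -> R) :
  (forall z w, `|f z - f w| <= Normc.normc (z - w)) -> continuous f.
Proof.
move=> lipf z; apply/(@cvgrPdist_lt _ _ _ (nbhs z) (nbhs_filter z)) => e e0.
apply/complex_nbhsP; exists e => // w; exact: le_lt_trans.
Qed.

Lemma normc_dist (z w : C) : `|Normc.normc z - Normc.normc w| <= Normc.normc (z - w).
Proof.
have h1 := le_normcD (z - w) w; have h2 := le_normcD (w - z) z.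
rewrite !subrK in h1 h2.
have h3 : Normc.normc (w - z) = Normc.normc (z - w) by rewrite -opprB normcN.
by rewrite ler_norml; apply/andP; split; lra.
Qed.

Lemma normRe_le (z : C) : `|complex.Re z| <= Normc.normc z.
Proof. by case: z => x y /=; rewrite -sqrtr_sqr ler_wsqrtr // lerDl sqr_ge0. Qed.

Lemma normIm_le (z : C) : `|complex.Im z| <= Normc.normc z.
Proof. by case: z => x y /=; rewrite -sqrtr_sqr ler_wsqrtr // lerDr sqr_ge0. Qed.

Lemma complex_Re_continuous : continuous (fun a : C => complex.Re a).
Proof.
apply: complex_lipschitz_continuous => z w; apply: le_trans (normRe_le _).
by case: z w => ? ? [].
Qed.

Lemma complex_normc_continuous : continuous (fun a : C => Normc.normc a).
Proof. exact/complex_lipschitz_continuous/normc_dist. Qed.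

Lemma conjc_continuous : continuous (fun a : C => a^*%C : C).
Proof.
move=> z A /complex_nbhsP[e e0 zA]; apply/complex_nbhsP; exists e => // w zw.
apply: zA; rewrite -rmorphB; case: (z - w) zw => x y /=.
by rewrite sqrrN.
Qed.

(** The disc is a closed subset of the continuous image of a compact real square. *)
Lemma complex_ball_compact (M : R) : compact [set a : C | Normc.normc a <= M].
Proof.
have cC : continuous (fun p : R * R => (Complex p.1 p.2 : C)).
  move=> [x y] A /complex_nbhsP[e e0 xyA].
  have e2 : 0 < e / 2 by rewrite divr_gt0.
  exists (ball x (e / 2), ball y (e / 2)); first by split; exact: nbhsx_ballx.
  move=> [x' y'] /= [bx by_]; apply: xyA => /=.
  have := le_normcD (Complex (x - x') 0) (Complex 0 (y - y')).
  have -> : Complex (x - x') 0 + Complex 0 (y - y') = Complex (x - x') (y - y').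
    by apply/eqP; rewrite eq_complex /= addr0 add0r !eqxx.
  move=> /le_lt_trans; apply => /=.
  rewrite expr0n /= addr0 add0r !sqrtr_sqr (splitr e) ltrD //.
apply: (@subclosed_compact _ _ ((fun p : R * R => (Complex p.1 p.2 : C)) @`
    (`[- M, M]%classic `*` `[- M, M]%classic))).
- apply: (@closed_preimage _ _ (fun a : C => Normc.normc a) [set x | x <= M]).
    exact: complex_normc_continuous.
  exact: closed_le.
- apply: continuous_compact; first exact: continuous_subspaceT.
  by apply: compact_setX; exact: segment_compact.
- move=> z /= zM; exists (complex.Re z, complex.Im z); last by case: z {zM}.
  split; rewrite /= in_itv /= -ler_norml (le_trans _ zM) //.
    exact: normRe_le.
  exact: normIm_le.
Qed.

Definition complex_embedding : hermitian_embedding R (R[i] : numFieldType) :=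
  @HermitianEmbedding R (R[i] : numFieldType) (@conjc R) idfun (fun r : R => r%:C%C)
    (fun=> erefl) (fun=> erefl) (or_intror (fun z => ex_intro _ z erefl))
    conjc_continuous complex_Re_continuous complex_normc_continuous
    complex_ball_compact.

End Instances.

Lemma exists_pow_le (R : realType) N (e : R) : 0 < e ->
  exists2 t, 1 < t & t ^+ N <= 1 + e.
Proof.
move=> e0; have N0 := ler0n R N.
have e1 : 0 < 1 + e by lra.
(* With [t = 1 / (1 - r)], Bernoulli reduces the goal to [1 <= (1 + e) * (1 - N * r)], that is
   [(1 + e) * N * r <= e]. *)
pose r := e / ((1 + e) * (N%:R + 1)).
have den : 0 < (1 + e) * (N%:R + 1) by rewrite mulr_gt0 // ltr_wpDl.
have r0 : 0 < r by rewrite divr_gt0.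
have er : r * ((1 + e) * (N%:R + 1)) = e by rewrite /r mulfVK // gt_eqF.
have r1 : r < 1 by rewrite ltr_pdivrMr // mul1r; nra.
have s0 : 0 < 1 - r by rewrite subr_gt0.
exists (1 - r)^-1; first by rewrite invf_gt1 //; lra.
have b : 1 - N%:R * r <= (1 - r) ^+ N by apply: bernoulli_le; rewrite !ltW.
rewrite exprVn invf_ple ?posrE ?exprn_gt0 //; apply: le_trans b.
by rewrite -[X in X <= _]mul1r ler_pdivrMr //; nra.
Qed.

(** * The John norm of a bundle *)

Section FiberwiseJohn.
Variables (R : realType) (S : scalar_field R) (X : topologicalType).
Local Notation K := (sc_K S).
Variable H : hermitian_embedding R K.
Hypothesis S_abs : forall a, sc_abs S a = ab H a.
Hypothesis S_ofR : forall r, sc_ofR S r = he_ofR H r.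
Hypothesis S_conj : forall a, sc_conj S a = he_conj H a.
Variables (B : bundle_data S X) (n : nat).
Hypotheses (hB : is_banach_bundle B) (hn : homogeneous B n).

Local Notation E := (@bd_E R S X B).
Local Notation pi := (@bd_pi R S X B).
Local Notation add := (@bd_add R S X B).
Local Notation scale := (@bd_scale R S X B).
Local Notation zero := (@bd_zero R S X B).
Local Notation norm := (@bd_norm R S X B).
Local Notation sub := (@bd_sub R S X B).

(** * Linear algebra in a fiber *)

Lemma pi_continuous : continuous pi. Proof. by case: hB => -[]. Qed.
Lemma pi_open U : open U -> open (pi @` U). Proof. by case: hB => -[_ h _] _; exact: h. Qed.

Lemma pi_add p q : pi p = pi q -> pi (add p q) = pi p.
Proof. by case: hB => _ [[h _ _] _]; exact: h. Qed.
Lemma pi_scale a p : pi (scale a p) = pi p.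
Proof. by case: hB => _ [[_ h _] _]; exact: h. Qed.
Lemma pi_zero x : pi (zero x) = x.
Proof. by case: hB => _ [[_ _ h] _]; exact: h. Qed.

Lemma addbA p q r : pi p = pi q -> pi q = pi r -> add (add p q) r = add p (add q r).
Proof. by case: hB => _ [_ [[h _] _]]; exact: h. Qed.
Lemma addbC p q : pi p = pi q -> add p q = add q p.
Proof. by case: hB => _ [_ [[_ [h _]] _]]; exact: h. Qed.
Lemma add0b p : add (zero (pi p)) p = p.
Proof. by case: hB => _ [_ [[_ [_ [h _]]] _]]; exact: h. Qed.
Lemma subbb p : sub p p = zero (pi p).
Proof. by case: hB => _ [_ [[_ [_ [_ [h _]]]] _]]; exact: h. Qed.
Lemma scalebDr a p q : pi p = pi q -> scale a (add p q) = add (scale a p) (scale a q).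
Proof. by case: hB => _ [_ [[_ [_ [_ [_ [h _]]]]] _]]; exact: h. Qed.
Lemma scalebDl a b p : scale (a + b) p = add (scale a p) (scale b p).
Proof. by case: hB => _ [_ [[_ [_ [_ [_ [_ [h _]]]]]] _]]; exact: h. Qed.
Lemma scalebA a b p : scale a (scale b p) = scale (a * b) p.
Proof. by case: hB => _ [_ [[_ [_ [_ [_ [_ [_ [h _]]]]]]] _]]; exact: h. Qed.
Lemma scale1b p : scale 1 p = p.
Proof. by case: hB => _ [_ [[_ [_ [_ [_ [_ [_ [_ h]]]]]]] _]]; exact: h. Qed.

Lemma normb_ge0 p : 0 <= norm p.
Proof. by case: hB => _ [_ [_ [[h _ _ _] _]]]; exact: h. Qed.
Lemma normb_eq0 p : norm p = 0 -> p = zero (pi p).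
Proof. by case: hB => _ [_ [_ [[_ h _ _] _]]]; exact: h. Qed.
Lemma normbZ a p : norm (scale a p) = ab H a * norm p.
Proof. by case: hB => _ [_ [_ [[_ _ h _] _]]]; rewrite h S_abs. Qed.
Lemma normbD p q : pi p = pi q -> norm (add p q) <= norm p + norm q.
Proof. by case: hB => _ [_ [_ [[_ _ _ h] _]]]; exact: h. Qed.

Lemma scaleb_continuous : continuous (fun ap : K * E => scale ap.1 ap.2).
Proof. by case: hB => _ [_ [_ [_ [_ [[h _ _] _]]]]]. Qed.
Lemma addb_continuous : {within [set pq : E * E | pi pq.1 = pi pq.2],
  continuous (fun pq : E * E => add pq.1 pq.2)}.
Proof. by case: hB => _ [_ [_ [_ [_ [[_ h _] _]]]]]. Qed.
Lemma normb_continuous : continuous norm.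
Proof. by case: hB => _ [_ [_ [_ [_ [[_ _ h] _]]]]]. Qed.
Lemma zero_nbhsP : zero_nbhs_axiom B.
Proof. by case: hB => _ [_ [_ [_ [_ [_ h]]]]]. Qed.

Lemma scale0b p : scale 0 p = zero (pi p).
Proof. by rewrite -[0](subrr 1) scalebDl scale1b -subbb. Qed.

Lemma scaleb0 a x : scale a (zero x) = zero x.
Proof. by have := scale0b (zero x); rewrite pi_zero => {1}<-; rewrite scalebA mulr0 scale0b pi_zero. Qed.

Lemma normb0 x : norm (zero x) = 0.
Proof. by have := scale0b (zero x); rewrite pi_zero => <-; rewrite normbZ ab0 mul0r. Qed.

Lemma pi_sub p q : pi p = pi q -> pi (sub p q) = pi p.
Proof. by move=> pq; rewrite pi_add ?pi_scale. Qed.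

Lemma subbK p q : pi p = pi q -> add (sub p q) q = p.
Proof.
move=> pq; rewrite addbA ?pi_scale // [add _ q]addbC ?pi_scale //.
have := subbb q; rewrite /bd_sub => ->; rewrite -pq addbC ?pi_zero //; exact: add0b.
Qed.

Lemma addbACA p q r s : pi p = pi q -> pi q = pi r -> pi r = pi s ->
  add (add p q) (add r s) = add (add p r) (add q s).
Proof.
move=> pq qr rs; rewrite addbA ?pi_add ?pq ?qr //.
rewrite -[add q (add r s)]addbA // [add q r]addbC // [add (add r q) s]addbA ?qr //.
by rewrite -addbA ?pi_add ?pq ?qr.
Qed.

(** The base point [y] is an argument because the sum starts from the zero of a definite fiber,
    which matters for [n = 0]. Families of points are row vectors in order to carry the product
    topology. *)
Definition lincomb y (q : 'rV[E]_n) (c : 'rV[K]_n) : E :=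
  \big[add/zero y]_(i < n) scale (c 0 i) (q 0 i).

Section InFiber.
Variables (y : X) (q : 'rV[E]_n).
Hypothesis qy : forall i, pi (q 0 i) = y.

Lemma pi_bigadd I (r : seq I) (F : I -> E) :
  (forall i, pi (F i) = y) -> pi (\big[add/zero y]_(i <- r) F i) = y.
Proof.
move=> Fy; elim: r => [|i r IH]; first by rewrite big_nil pi_zero.
by rewrite big_cons pi_add Fy ?IH.
Qed.

Lemma pi_lincomb c : pi (lincomb y q c) = y.
Proof. by apply: pi_bigadd => i; rewrite pi_scale. Qed.

Lemma lincombD c d : lincomb y q (c + d) = add (lincomb y q c) (lincomb y q d).
Proof.
rewrite /lincomb; elim: (index_enum _) => [|i r IH].
  by rewrite !big_nil -{2}[y]pi_zero add0b.
have py e : pi (\big[add/zero y]_(j <- r) scale (e 0 j) (q 0 j)) = y.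
  by apply: pi_bigadd => j; rewrite pi_scale.
by rewrite !big_cons IH mxE scalebDl addbACA ?py ?pi_scale ?qy.
Qed.

Lemma lincombZ a c : lincomb y q (a *: c) = scale a (lincomb y q c).
Proof.
rewrite /lincomb; elim: (index_enum _) => [|i r IH].
  by rewrite !big_nil scaleb0.
have py e : pi (\big[add/zero y]_(j <- r) scale (e 0 j) (q 0 j)) = y.
  by apply: pi_bigadd => j; rewrite pi_scale.
by rewrite !big_cons IH mxE scalebDr ?py ?pi_scale ?qy // scalebA.
Qed.

Lemma lincomb0 : lincomb y q 0 = zero y.
Proof. by rewrite -(scale0r 0) lincombZ scale0b pi_lincomb. Qed.

Lemma lincomb_sum I (r : seq I) (F : I -> 'rV[K]_n) :
  lincomb y q (\sum_(i <- r) F i) = \big[add/zero y]_(i <- r) lincomb y q (F i).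
Proof.
elim: r => [|i r IH]; first by rewrite !big_nil lincomb0.
by rewrite !big_cons lincombD IH.
Qed.

End InFiber.

(** * Bases and coordinates of the fibers *)

Lemma basis_exists x : exists b : 'rV[E]_n, (forall i, pi (b 0 i) = x) /\
  forall p, pi p = x -> exists! c : 'rV[K]_n, p = lincomb x b c.
Proof.
have [b [bx bb]] := hn x; exists (\row_i b i); split => [i|p px].
  by rewrite mxE.
have [c [ec uc]] := bb p px; exists (\row_i c i); split.
  by rewrite ec; apply: eq_bigr => i _; rewrite !mxE.
move=> d ed; apply/rowP => i; rewrite mxE; congr (_ i).
have -> : c = (fun i => d 0 i) by apply: uc; rewrite ed; apply: eq_bigr => j _; rewrite mxE.
by [].
Qed.

(** The bases are chosen in each fiber separately, with no continuity in [x]. *)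
Definition basis x : 'rV[E]_n := sval (cid (basis_exists x)).

Lemma pi_basis x i : pi (basis x 0 i) = x.
Proof. by rewrite /basis; case: cid => b []. Qed.

Lemma coord_exists p : exists c : 'rV[K]_n, lincomb (pi p) (basis (pi p)) c = p.
Proof.
rewrite /basis; case: cid => b [_ bb] /=.
by have [c [ec _]] := bb p erefl; exists c.
Qed.

Definition coord p : 'rV[K]_n := sval (cid (coord_exists p)).

Lemma lincomb_coord p : lincomb (pi p) (basis (pi p)) (coord p) = p.
Proof. by rewrite /coord; case: cid. Qed.

Lemma lincomb_basis_inj x : injective (lincomb x (basis x)).
Proof.
rewrite /basis; case: cid => b [bx bb] /= c d cd.
have [e [_ ue]] := bb _ (pi_lincomb bx c).
by rewrite -(ue c) // -(ue d).
Qed.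

Lemma coord_lincomb_basis x c : coord (lincomb x (basis x) c) = c.
Proof.
apply: (@lincomb_basis_inj x); have := lincomb_coord (lincomb x (basis x) c).
by rewrite pi_lincomb //; exact: pi_basis.
Qed.

Lemma coordD p q : pi p = pi q -> coord (add p q) = coord p + coord q.
Proof.
move=> pq; apply: (@lincomb_basis_inj (pi p)).
rewrite lincombD; last exact: pi_basis.
by rewrite -[in LHS](pi_add pq) lincomb_coord lincomb_coord pq lincomb_coord.
Qed.

Lemma coordZ a p : coord (scale a p) = a *: coord p.
Proof.
apply: (@lincomb_basis_inj (pi p)).
rewrite lincombZ; last exact: pi_basis.
by rewrite -[in LHS](pi_scale a) lincomb_coord lincomb_coord.
Qed.

(** The matrix on the right is the transition from the family [q] to the chosen basis at [y]; it
    becomes the [G] of [john_change]. *)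
Lemma coord_lincomb y (q : 'rV[E]_n) c : (forall i, pi (q 0 i) = y) ->
  coord (lincomb y q c) = c *m \matrix_i coord (q 0 i).
Proof.
move=> qy; rewrite -[RHS](coord_lincomb_basis y); congr coord.
rewrite mulmx_sum_row lincomb_sum; last exact: pi_basis.
apply: eq_bigr => i _; rewrite rowK -coordZ.
by rewrite -(qy i) -(pi_scale (c 0 i)) lincomb_coord.
Qed.

(** * The John norm in each fiber *)

Definition fiber_norm x (c : 'rV[K]_n) : R := norm (lincomb x (basis x) c).

Lemma fiber_norm_is_norm x : is_norm H (fiber_norm x).
Proof.
have bx := @pi_basis x; split.
- move=> c /normb_eq0; rewrite pi_lincomb // -(lincomb0 bx).
  exact: lincomb_basis_inj.
- by move=> a c; rewrite /fiber_norm lincombZ // normbZ.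
- by move=> c d; rewrite /fiber_norm lincombD // normbD // !pi_lincomb.
Qed.

Lemma fiber_norm_coord p : fiber_norm (pi p) (coord p) = norm p.
Proof. by rewrite /fiber_norm lincomb_coord. Qed.

(** A maximiser is picked in each fiber separately; continuity of the outcome rests on
    [john_stable], which compares arbitrary maximisers. *)
Definition john_mx x : 'M[K]_n := sval (cid (john_exists (fiber_norm_is_norm x))).

Lemma john_mxP x : john H (fiber_norm x) (john_mx x).
Proof. by rewrite /john_mx; case: cid. Qed.

Lemma john_mx_pd_inv x : pd H (invmx (john_mx x)).
Proof. exact: john_pd_inv (fiber_norm_is_norm x) (john_mxP x). Qed.

Definition john_inner (p q : E) : K :=
  sesq H (invmx (john_mx (pi p))) (coord p) (coord q).

Definition john_norm (p : E) : R :=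
  Num.sqrt (qf H (invmx (john_mx (pi p))) (coord p)).

Lemma sqr_john_norm p : john_norm p ^+ 2 = qf H (invmx (john_mx (pi p))) (coord p).
Proof. by rewrite sqr_sqrtr // pd_ge0 //; exact: john_mx_pd_inv. Qed.

Lemma john_norm_ge p : norm p <= john_norm p.
Proof.
rewrite -ler_sqr ?nnegrE ?normb_ge0 ?sqrtr_ge0 // sqr_john_norm -fiber_norm_coord.
exact: john_lower (fiber_norm_is_norm _) (john_mxP _).
Qed.

Lemma john_norm_le p : john_norm p <= Num.sqrt n%:R * norm p.
Proof.
rewrite -ler_sqr ?nnegrE ?mulr_ge0 ?normb_ge0 ?sqrtr_ge0 // sqr_john_norm exprMn.
rewrite sqr_sqrtr ?ler0n // -fiber_norm_coord.
exact: john_upper (fiber_norm_is_norm _) (john_mxP _).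
Qed.

Lemma john_normZ a p : john_norm (scale a p) = ab H a * john_norm p.
Proof.
rewrite /john_norm pi_scale coordZ qf_scale; last by case: (john_mx_pd_inv (pi p)).
by rewrite sqrtrM ?sqr_ge0 // sqrtr_sqr ger0_norm // ab_ge0.
Qed.

Lemma john_normD p q : pi p = pi q -> john_norm (add p q) <= john_norm p + john_norm q.
Proof.
move=> pq; rewrite /john_norm pi_add // coordD // -pq.
by apply: sqrt_qfD; exact: john_mx_pd_inv.
Qed.

Lemma john_norm_sub p q : pi p = pi q ->
  `|john_norm p - john_norm q| <= Num.sqrt n%:R * norm (sub p q).
Proof.
move=> pq.
have h1 := john_normD (p := sub p q) (q := q); rewrite pi_sub // subbK // in h1.
have h2 := john_normD (p := sub q p) (q := p); rewrite pi_sub // subbK // in h2.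
have h3 := john_norm_le (sub p q).
have e : sub q p = scale (-1) (sub p q).
  rewrite /bd_sub scalebDr ?pi_scale // scalebA mulrNN mulr1 scale1b addbC //.
  by rewrite pi_scale.
have h4 : john_norm (sub q p) = john_norm (sub p q).
  by rewrite e john_normZ /ab rmorphN rmorph1 normcN Normc.normc1 mul1r.
rewrite h4 in h2; have {}h1 := h1 pq; have {}h2 := h2 (esym pq).
by rewrite ler_norml; apply/andP; split; lra.
Qed.

(** * Continuity of the John norm on the total space *)

Lemma row_entry_continuous (T : topologicalType) m (i : 'I_m) :
  continuous (fun q : 'rV[T]_m => q 0 i).
Proof.
move=> b A bA; exists (fun _ j => if j == i then A else setT) => [k j|q].
  rewrite ord1; case: eqP => [->|_] //.
  exact: (@filterT _ (nbhs (b 0 j)) (nbhs_filter _)).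
by move=> /(_ 0 i); rewrite eqxx.
Qed.

(** Addition is controlled only inside a common fiber, so limits of linear combinations are taken
    along neighbourhoods restricted to this set. *)
Definition fibered : set (E * 'rV[E]_n) :=
  [set z | forall i, pi ((z.2 : 'rV[E]_n) 0 i) = pi z.1].

Definition fibered_nbhs (z : E * 'rV[E]_n) : set_system (E * 'rV[E]_n) :=
  within fibered (nbhs z).

Lemma fibered_nbhs_filter z : Filter (fibered_nbhs z).
Proof. exact: within_filter (nbhs_filter z). Qed.

Lemma fibered_nbhs_fibered z : fibered_nbhs z fibered.
Proof. by rewrite /fibered_nbhs /within /=; apply: filterE. Qed.

(* Openness of [pi] provides families [q] close to [b] over every point near [x];
   no continuous section is needed. *)
Lemma near_fibered p0 (b : 'rV[E]_n) (P : E -> 'rV[E]_n -> Prop) :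
  (forall i, pi (b 0 i) = pi p0) ->
  (\forall z \near fibered_nbhs (p0, b), P z.1 z.2) ->
  \forall p \near p0, exists q : 'rV[E]_n, (forall i, pi (q 0 i) = pi p) /\ P p q.
Proof.
move=> bx [[V W] /= [nV [Wb nWb sW]] VW].
have nx i : nbhs (pi p0) (pi @` Wb 0 i).
  have := nWb 0 i; rewrite nbhsE => -[U [oU Ub] UW].
  apply: (@filterS _ _ _ (pi @` U)); first exact: image_subset.
  by apply: open_nbhs_nbhs; split; [exact: pi_open | exists (b 0 i)].
have : \forall p \near p0, forall i, (pi @` Wb 0 i) (pi p).
  by apply: (@filter_forall _ _ _ (nbhs p0) _) => i; exact: pi_continuous (nx i).
apply: filterS2 nV => p Vp Wp.
have /choice[q qP] : forall i, exists r, Wb 0 i r /\ pi r = pi p.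
  by move=> i; have [r Wr rp] := Wp i; exists r.
exists (\row_i q i); split => [i|]; first by rewrite mxE; case: (qP i).
apply: (VW (p, \row_i q i)).
  split => //=; apply: sW => i j; rewrite ord1 mxE; by case: (qP j).
by move=> i /=; rewrite mxE; case: (qP i).
Qed.

Lemma zero_continuous : continuous zero.
Proof.
move=> x A /zero_nbhsP[U [e [oU Ux e0 UA]]].
apply: (@filterS _ _ _ U); last by apply: open_nbhs_nbhs; split.
by move=> y Uy; apply: UA; rewrite /= pi_zero normb0.
Qed.

Lemma cvg_add T (G : set_system T) (u v : T -> E) p q : Filter G ->
  u @ G --> p -> v @ G --> q -> pi p = pi q ->
  (\forall t \near G, pi (u t) = pi (v t)) ->
  (fun t => add (u t) (v t)) @ G --> add p q.
Proof.
move=> FG up vq pq puv.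
have /subspace_continuousP/(_ (p, q) pq) := addb_continuous; apply: cvg_trans.
move=> A wA; have : (fun t => (u t, v t)) @ G --> (p, q) by exact: cvg_pair.
by move=> /(_ _ wA); apply: filterS2 puv => t puv; apply.
Qed.

Lemma cvg_lincomb T (G : set_system T) (y : T -> X) (q : T -> 'rV[E]_n)
    (c : T -> 'rV[K]_n) y0 (q0 : 'rV[E]_n) (c0 : 'rV[K]_n) : Filter G ->
  y @ G --> y0 -> (forall i, (fun t => q t 0 i) @ G --> q0 0 i) ->
  (forall i, (fun t => c t 0 i) @ G --> c0 0 i) ->
  (forall i, pi (q0 0 i) = y0) ->
  (\forall t \near G, forall i, pi (q t 0 i) = y t) ->
  (fun t => lincomb (y t) (q t) (c t)) @ G --> lincomb y0 q0 c0.
Proof.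
move=> FG yy0 qq0 cc0 q0y qy; rewrite /lincomb.
elim: (index_enum _) => [|i r IH].
  rewrite big_nil; under eq_fun do rewrite big_nil.
  exact: (cvg_comp y zero yy0 (@zero_continuous y0)).
rewrite big_cons; under eq_fun do rewrite big_cons.
apply: cvg_add => //.
- exact: (cvg_comp (fun t => (c t 0 i, q t 0 i)) (fun ap : K * E => scale ap.1 ap.2)
    (cvg_pair (cc0 i) (qq0 i)) (@scaleb_continuous (c0 0 i, q0 0 i))).
- by rewrite pi_scale q0y pi_bigadd // => j; rewrite pi_scale.
- apply: filterS qy => t qy; rewrite pi_scale qy pi_bigadd // => j.
  by rewrite pi_scale.
Qed.

(** The norm of a combination is jointly continuous in the coefficients and the family. Compactness
    of the [l1] sphere makes the approximation uniform over the coefficients on it, and homogeneity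
    extends it to all coefficients. *)
Lemma fiber_norm_near p0 (t : R) : 1 < t ->
  \forall z \near fibered_nbhs (p0, basis (pi p0)), forall c,
    fiber_norm (pi p0) c <= t * norm (lincomb (pi z.1) z.2 c) /\
    norm (lincomb (pi z.1) z.2 c) <= t * fiber_norm (pi p0) c.
Proof.
move=> t1; set x := pi p0; set b := basis x; set F := fibered_nbhs _.
have nN := fiber_norm_is_norm x.
have [m m0 mN] := is_norm_ge_l1 nN.
have t0 : 0 < t := lt_trans ltr01 t1.
have ti : t^-1 < 1 by rewrite invf_lt1.
(* On the sphere the norm [u] at [x] is at least [m], so an additive error [e] is at most
   [(1 - t^-1) * u]. This gives the lower factor [t^-1], and the upper factor [2 - t^-1 <= t]. *)
pose e := (1 - t^-1) * m; have e0 : 0 < e by rewrite mulr_gt0 // subr_gt0.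
have FF : Filter F by exact: fibered_nbhs_filter.
have cov (c0 : 'rV[K]_n) : \forall c \near c0 & z \near F,
    `|fiber_norm x c - norm (lincomb (pi z.1) z.2 c)| <= e.
  pose G := filter_prod (nbhs c0) F.
  have FG : Filter G  := @filter_prod_filter _ _ _ _ (nbhs_filter c0) FF.
  have cvg_z : (fun t : 'rV[K]_n * (E * 'rV[E]_n) => t.2) @ G --> nbhs (p0, b).
    by apply: cvg_trans (cvg_within _); exact: cvg_snd.
  have cvg1 : (fun t : 'rV[K]_n * (E * 'rV[E]_n) =>
      norm (lincomb (pi t.2.1) t.2.2 t.1)) @ G --> fiber_norm x c0.
    apply: (cvg_comp (fun t => lincomb (pi t.2.1) t.2.2 t.1) norm _
      (@normb_continuous _)).
    apply: cvg_lincomb.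
    - apply: (cvg_comp (fun t => t.2.1) pi _ (@pi_continuous p0)).
      exact: (cvg_comp (fun t => t.2) fst cvg_z cvg_fst).
    - move=> i; have := @row_entry_continuous _ _ i b.
      apply: (cvg_comp (fun t => t.2.2) (fun q : 'rV[E]_n => q 0 i)).
      exact: (cvg_comp (fun t => t.2) snd cvg_z cvg_snd).
    - move=> i; exact: (cvg_comp fst (fun c : 'rV[K]_n => c 0 i) (@cvg_fst _ _ _ _ FF)
        (@row_entry_continuous K _ i c0)).
    - exact: pi_basis.
    - exact: (@cvg_snd _ _ _ _ (nbhs_filter c0) _ (fibered_nbhs_fibered (p0, b))).
  have cvg2 : (fun t : 'rV[K]_n * (E * 'rV[E]_n) => fiber_norm x t.1) @ G
      --> fiber_norm x c0.
    exact: (cvg_comp fst (fiber_norm x) (@cvg_fst _ _ _ _ FF) (is_norm_continuous nN (x := c0))).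
  have := cvgB cvg2 cvg1; move=> /(_ FG).
  rewrite subrr => /(@cvgr0Pnorm_le _ _ _ G FG)/(_ e e0).
  by apply.
have /compact_near_coveringP/(_ _ F
    (fun z c => `|fiber_norm x c - norm (lincomb (pi z.1) z.2 c)| <= e) FF) :=
  @l1_sphere_compact _ _ H n.
move=> /(_ (fun c0 _ => cov c0)) near_sphere.
near=> z => c.
have zfib : forall i, pi (z.2 0 i) = pi z.1.
  by near: z; exact: fibered_nbhs_fibered.
have zs : forall d, l1 H d = 1 ->
    `|fiber_norm x d - norm (lincomb (pi z.1) z.2 d)| <= e.
  by near: z; apply: filterS near_sphere => z h d; exact: h.
have [c0|c0] := eqVneq (l1 H c) 0.
  rewrite (l1_eq0 c0) (lincomb0 zfib) normb0 (is_norm0 nN) mulr0 //.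
set l := l1 H c in c0.
have l0 : 0 < l by rewrite lt_def c0 l1_ge0.
pose d := he_ofR H l^-1 *: c.
have labs : ab H (he_ofR H l) = l by rewrite ab_ofR gtr0_norm.
have ed : c = he_ofR H l *: d.
  by rewrite scalerA -ofRM divff // ofR1 scale1r.
have d1 : l1 H d = 1.
  by rewrite l1Z ab_ofR gtr0_norm ?invr_gt0 // mulVf.
have := zs d d1; have := mN d; rewrite d1 mulr1.
rewrite ed (lincombZ zfib) normbZ; have [_ -> _] := nN; rewrite labs.
move: (fiber_norm x d) (norm _) => u v mu; rewrite ler_distl => /andP[h1 h2].
have eu : e <= (1 - t^-1) * u by rewrite ler_wpM2l // subr_ge0 ltW.
have u0 : 0 < u by apply: lt_le_trans mu.
have tt : t * t^-1 = 1 by rewrite divff // gt_eqF.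
split.
  rewrite mulrCA ler_pM2l //; have : t^-1 * u <= v by lra.
  by move=> /(ler_wpM2l (ltW t0)); rewrite mulrA tt mul1r.
rewrite mulrCA ler_pM2l //; nra.
Unshelve. all: by end_near. Qed.

Lemma lincomb_basis_mul y (q : 'rV[E]_n) c : (forall i, pi (q 0 i) = y) ->
  lincomb y (basis y) (c *m \matrix_i coord (q 0 i)) = lincomb y q c.
Proof.
move=> qy; rewrite -(coord_lincomb _ qy) -{1 2}(pi_lincomb qy c).
exact: lincomb_coord.
Qed.

(** The family [q] near the basis at [p0] induces a norm [N'] within a factor [t] of the norm at
    [p0]. By [john_change] its maximiser is the one of the nearby fiber read in the coordinates of
    [q], and [john_stable] applies in both directions. *)
Lemma john_norm_lincomb_near p0 (d : R) : 0 < d ->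
  \forall z \near fibered_nbhs (p0, basis (pi p0)), forall c,
    qf H (invmx (john_mx (pi p0))) c <=
      (1 + d) * john_norm (lincomb (pi z.1) z.2 c) ^+ 2 /\
    john_norm (lincomb (pi z.1) z.2 c) ^+ 2 <=
      (1 + d) * qf H (invmx (john_mx (pi p0))) c.
Proof.
move=> d0; have [t t1 t_le] : exists2 t : R, 1 < t &
    t ^+ (4 * n) <= 1 + d ^+ 2 / (4 * (1 + d)).
  by apply: exists_pow_le; rewrite divr_gt0 ?exprn_gt0 // mulr_gt0 // addr_gt0.
have := fibered_nbhs_fibered (p0, basis (pi p0)).
have FF := fibered_nbhs_filter (p0, basis (pi p0)).
apply: filterS2 (fiber_norm_near p0 t1) => -[p q] /= near_t qp c.
set x := pi p0 in near_t *; set y := pi p in near_t qp *.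
pose G := \matrix_i coord (q 0 i).
pose N' u := fiber_norm y (u *m G).
have eN' u : N' u = norm (lincomb y q u) by rewrite /N' /fiber_norm lincomb_basis_mul.
have [NxI _ _] := fiber_norm_is_norm x.
(* A vector killed by [G] has [N'] zero, hence norm zero at [x]; so [q] is again a basis. *)
have Gu : G \in unitmx.
  rewrite -row_free_unit -kermx_eq0; apply/rowV0P => v /sub_kermxP vG0.
  apply: NxI; apply/eqP; rewrite eq_le (is_norm_ge0 _ (fiber_norm_is_norm x)) andbT.
  have [h _] := near_t v; apply: le_trans h _.
  by rewrite -eN' /N' vG0 (is_norm0 (fiber_norm_is_norm y)) mulr0.
have nN' : is_norm H N'.
  have [NyI NyZ NyD] := fiber_norm_is_norm y; split.
  - move=> u /NyI/(congr1 (mulmx^~ (invmx G))).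
    by rewrite mulmxK // mul0mx.
  - by move=> a u; rewrite /N' -scalemxAl NyZ.
  - by move=> u v; rewrite /N' mulmxDl NyD.
have jN' := john_change Gu (fun u => erefl (N' u)) (john_mxP y).
have nNx := fiber_norm_is_norm x.
have le1 u : fiber_norm x u <= t * N' u by rewrite eN'; case: (near_t u).
have le2 u : N' u <= t * fiber_norm x u by rewrite eN'; case: (near_t u).
have eJ : john_norm (lincomb y q c) ^+ 2 = qf H (invmx (john_mx y)) (c *m G).
  by rewrite sqr_john_norm pi_lincomb // coord_lincomb.
rewrite eJ -(qf_inv_change H _ Gu (john_unit (john_mxP y))).
split; first exact: john_stable nNx nN' (john_mxP x) jN' le1 le2 (ltW t1) d0 t_le c.
exact: john_stable nN' nNx jN' (john_mxP x) le2 le1 (ltW t1) d0 t_le c.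
Qed.

(** Both [z.1] and the combination with the coordinates of [p0] tend to [p0], so their difference
    tends to a zero vector. *)
Lemma lincomb_near p0 (e : R) : 0 < e ->
  \forall z \near fibered_nbhs (p0, basis (pi p0)),
    norm (sub z.1 (lincomb (pi z.1) z.2 (coord p0))) < e.
Proof.
move=> e0; set b := basis _; set F := fibered_nbhs _.
have FF : Filter F := fibered_nbhs_filter _.
have FN : F --> nbhs (p0, b) by exact: (@cvg_within _ _ (nbhs_filter _)).
have cvg1 : (fun z : E * 'rV[E]_n => z.1) @ F --> p0.
  by apply: cvg_trans (@cvg_fst _ _ (nbhs p0) (nbhs b) (nbhs_filter b)); exact: cvg_app FN.
have cvg2 : (fun z : E * 'rV[E]_n => z.2) @ F --> b.
  by apply: cvg_trans (@cvg_snd _ _ (nbhs p0) (nbhs b) (nbhs_filter p0)); exact: cvg_app FN.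
have fibF : \forall z \near F, forall i, pi ((z.2 : 'rV[E]_n) 0 i) = pi z.1.
  exact: fibered_nbhs_fibered.
have cvgl : (fun z : E * 'rV[E]_n => lincomb (pi z.1) z.2 (coord p0)) @ F --> p0.
  rewrite -[X in _ --> nbhs X](lincomb_coord p0); apply: cvg_lincomb => //.
  - exact: (cvg_comp (fun z => z.1) pi cvg1 (@pi_continuous p0)).
  - by move=> i; exact: (cvg_comp (fun z => z.2) (fun q : 'rV[E]_n => q 0 i) cvg2
      (@row_entry_continuous _ _ i b)).
  - by move=> i; exact: cvg_cst.
  - exact: pi_basis.
have : (fun z : E * 'rV[E]_n => norm (sub z.1 (lincomb (pi z.1) z.2 (coord p0)))) @ F
    --> norm (sub p0 p0).
  apply: (cvg_comp (fun z : E * 'rV[E]_n =>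
    sub z.1 (lincomb (pi z.1) z.2 (coord p0))) norm _ (@normb_continuous _)).
  apply: cvg_add => //.
  - exact: (cvg_comp (fun z : E * 'rV[E]_n => (-1 : K, lincomb (pi z.1) z.2 (coord p0)))
      (fun ap : K * E => scale ap.1 ap.2) (cvg_pair (cvg_cst _) cvgl)
      (@scaleb_continuous (-1, p0))).
  - by rewrite pi_scale.
  - by apply: filterS fibF => z zf; rewrite pi_scale pi_lincomb.
rewrite subbb normb0 => /(@cvgr0Pnorm_lt _ _ _ F FF)/(_ e e0).
by apply: filterS => z; rewrite ger0_norm // normb_ge0.
Qed.

(** The passage from [p0] to a nearby [p] goes through the combination of [q] with the coordinates
    of [p0]. [john_norm_lincomb_near] controls the change of fiber, [lincomb_near] with
    [john_norm_sub] the move to [p] inside its fiber. *)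
Lemma john_norm_continuous : continuous john_norm.
Proof.
move=> p0; apply/(@cvgrPdist_le _ _ _ (nbhs p0) (nbhs_filter p0)) => e e0.
set s := john_norm p0; have s0 : 0 <= s by exact: sqrtr_ge0.
have den : 0 < 4 * (s + 1) + e by lra.
(* Chosen so that [d <= 1] and [d * (4 * s) <= e]: the error across fibers, at most [2 * (d * s)],
   is then at most [e / 2]. The constant [f] takes care of the other half. *)
pose d := e / (4 * (s + 1) + e).
have d0 : 0 < d by rewrite divr_gt0.
have d1 : d <= 1 by rewrite ler_pdivrMr //; lra.
have ds : d * (4 * s) <= e.
  have : d * (4 * (s + 1) + e) = e by rewrite /d mulfVK // gt_eqF.
  by nra.
have n0 := sqrtr_ge0 (n%:R : R).
pose f := e / (2 * (Num.sqrt n%:R + 1)).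
have nden : 0 < 2 * (Num.sqrt n%:R + 1) :> R by lra.
have f0 : 0 < f by rewrite divr_gt0.
have nf : Num.sqrt n%:R * f <= e / 2.
  have : f * (2 * (Num.sqrt n%:R + 1)) = e by rewrite /f mulfVK // gt_eqF.
  by nra.
have bx i : pi (basis (pi p0) 0 i) = pi p0 by exact: pi_basis.
have FF := fibered_nbhs_filter (p0, basis (pi p0)).
have near_q := @filterI _ _ FF _ _ (john_norm_lincomb_near p0 d0) (lincomb_near p0 f0).
have := near_fibered (P := fun p q => (forall c,
    qf H (invmx (john_mx (pi p0))) c <= (1 + d) * john_norm (lincomb (pi p) q c) ^+ 2 /\
    john_norm (lincomb (pi p) q c) ^+ 2 <= (1 + d) * qf H (invmx (john_mx (pi p0))) c) /\
  norm (sub p (lincomb (pi p) q (coord p0))) < f) bx near_q.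
apply: (@filterS _ (nbhs p0) (nbhs_filter p0)) => p [q [qp [/(_ (coord p0)) [h1 h2] h3]]].
rewrite -!sqr_john_norm -/s in h1 h2.
have h4 : `|john_norm p - john_norm (lincomb (pi p) q (coord p0))| <= e / 2.
  apply: le_trans (john_norm_sub _) _; first by rewrite pi_lincomb.
  by apply: le_trans nf; rewrite ler_wpM2l // ltW.
set J := john_norm (lincomb _ _ _) in h1 h2 h4.
have J0 : 0 <= J by exact: sqrtr_ge0.
(* The estimates concern squares; [1 + d <= (1 + d)^2] avoids a square root of [1 + d]. *)
have sJ : s <= (1 + d) * J.
  rewrite -ler_sqr ?nnegrE ?mulr_ge0 ?addr_ge0 ?(ltW d0) //.
  apply: (le_trans h1); rewrite exprMn ler_wpM2r ?sqr_ge0 //; nra.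
have Js : J <= (1 + d) * s.
  rewrite -ler_sqr ?nnegrE ?mulr_ge0 ?addr_ge0 ?(ltW d0) //.
  apply: (le_trans h2); rewrite exprMn ler_wpM2r ?sqr_ge0 //; nra.
move: h4; rewrite !ler_norml => /andP[h5 h6]; apply/andP.
have dJ : d * J <= 2 * (d * s) by nra.
by split; nra.
Qed.

(** * The Hilbert bundle with the John norm and its distance from [B] *)

Definition john_bundle : bundle_data S X :=
  @BundleData R S X E pi add scale zero john_norm.

Lemma john_norm0P p : john_norm p = 0 -> p = zero (pi p).
Proof.
move=> p0; apply: normb_eq0; apply/eqP; rewrite eq_le normb_ge0 andbT -p0.
exact: john_norm_ge.
Qed.

(** The added 1 keeps the radius [e / (Num.sqrt n%:R + 1)] positive when [n = 0]. *)
Lemma sqrt_n_gt0 : (0 < Num.sqrt n%:R + 1 :> R).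
Proof. by rewrite ltr_wpDl ?sqrtr_ge0. Qed.

Lemma john_norm_lt p (e : R) : norm p < e / (Num.sqrt n%:R + 1) -> john_norm p < e.
Proof.
rewrite ltr_pdivlMr ?sqrt_n_gt0 // => h.
apply: le_lt_trans h; apply: le_trans (john_norm_le p) _.
by rewrite mulrC ler_wpM2l ?normb_ge0 // lerDl.
Qed.

(** Only the norm has changed. Completeness and the neighbourhoods of zero transfer through the
    two-sided comparison with the old norm. *)
Lemma john_bundle_is_banach : is_banach_bundle john_bundle.
Proof.
have [h1 [h2 [h3 [_ [complete [[scale_cont add_cont _] _]]]]]] := hB.
split; first exact: h1.
split; first exact: h2.
split; first exact: h3.
split.
  split => /=.
  - by move=> p; exact: sqrtr_ge0.
  - exact: john_norm0P.
  - by move=> a p; rewrite john_normZ S_abs.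
  - exact: john_normD.
split.
  move=> x u ux cauchy_u.
  have [e e0|p [px up]] := complete x u ux.
    have [m mu] := cauchy_u e e0; exists m => i j mi mj.
    exact: le_lt_trans (john_norm_ge _) (mu i j mi mj).
  exists p; split => // e e0.
  have [|m mu] := up (e / (Num.sqrt n%:R + 1)).
    by rewrite divr_gt0 ?sqrt_n_gt0.
  by exists m => k mk; apply: john_norm_lt; exact: mu.
split; first by split => //; exact: john_norm_continuous.
move=> x A; rewrite (zero_nbhsP x A) /=; split => -[U [e [oU Ux e0 UA]]].
  exists U, e; split => // p [Up pe]; apply: UA; split => //.
  exact: le_lt_trans (john_norm_ge p) pe.
exists U, (e / (Num.sqrt n%:R + 1)); split => //.
  by rewrite divr_gt0 ?sqrt_n_gt0.
by move=> p [Up pe]; apply: UA; split => //; exact: john_norm_lt.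
Qed.

Lemma john_bundle_is_hilbert : is_hilbert_bundle john_bundle.
Proof.
split; first exact: john_bundle_is_banach.
exists john_inner => a p q r /= pr qr.
have hP := (john_mx_pd_inv (pi r)).1.
split.
- by rewrite /john_inner pi_add ?pr ?qr // coordD ?pr ?qr // sesqDl.
- by rewrite /john_inner pi_scale coordZ sesqZl.
- by rewrite /john_inner pr S_conj -sesqC.
- rewrite /john_inner pr S_ofR sqr_john_norm pr; exact: sesq_self.
Qed.

Let bounded_john s : @bounded_section R S X john_bundle s <-> @bounded_section R S X B s.
Proof.
split => -[cs ps [M sM]]; split => //.
  by exists M => x; exact: le_trans (john_norm_ge _) (sM x).
exists (Num.sqrt n%:R * M) => x /=; apply: le_trans (john_norm_le _) _.
by rewrite ler_wpM2l ?sqrtr_ge0.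
Qed.

Lemma le_supnorm (B0 : bundle_data S X) (s : X -> bd_E B0) x :
  bounded_section s -> bd_norm (s x) <= supnorm s.
Proof.
move=> [_ _ [M sM]]; apply: sup_upper_bound; last by right; exists x.
split; first by exists 0; left.
exists (Num.max 0 M) => _ [->|[y _ <-]]; first by rewrite le_max lexx.
by rewrite le_max sM orbT.
Qed.

Lemma supnorm_ge0 (B0 : bundle_data S X) (s : X -> bd_E B0) :
  bounded_section s -> 0 <= supnorm s.
Proof.
move=> [_ _ [M sM]]; apply: sup_upper_bound; last by left.
split; first by exists 0; left.
exists (Num.max 0 M) => _ [->|[y _ <-]]; first by rewrite le_max lexx.
by rewrite le_max sM orbT.
Qed.

Lemma supnorm_le (B0 : bundle_data S X) (s : X -> bd_E B0) (M : R) :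
  0 <= M -> (forall x, bd_norm (s x) <= M) -> supnorm s <= M.
Proof.
move=> M0 sM; apply: ge_sup; first by exists 0; left.
by move=> _ [->|[x _ <-]].
Qed.

Let supnorm_john_le s : @bounded_section R S X B s ->
  @supnorm R S X john_bundle s <= Num.sqrt n%:R * @supnorm R S X B s.
Proof.
move=> bs; apply: supnorm_le => [|x]; first by rewrite mulr_ge0 ?sqrtr_ge0 ?supnorm_ge0.
apply: le_trans (john_norm_le _) _; rewrite ler_wpM2l ?sqrtr_ge0 //.
exact: le_supnorm.
Qed.

Let supnorm_john_ge s : @bounded_section R S X B s ->
  @supnorm R S X B s <= @supnorm R S X john_bundle s.
Proof.
move=> bs; have bs' := (bounded_john s).2 bs.
apply: supnorm_le => [|x]; first exact: supnorm_ge0.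
exact: le_trans (john_norm_ge _) (le_supnorm x bs').
Qed.

Lemma john_admissible : @admissible_renorming R S X B john_bundle idfun.
Proof.
split.
- split => //; first by move=> p; exact: cvg_id.
  by exists idfun; split => //; move=> p; exact: cvg_id.
- by move=> s /bounded_john.
- by move=> s /bounded_john bs; exists s.
- by exists (Num.sqrt n%:R) => s; exact: supnorm_john_le.
- by exists 1 => s bs; rewrite mul1r; exact: supnorm_john_ge.
Qed.

Lemma dbBM_john_le : (dbBM B john_bundle <= (2^-1 * ln (n%:R : R))%:E)%E.
Proof.
pose T := @opnorm_T R S X B john_bundle idfun.
pose Tinv := @opnorm_Tinv R S X B john_bundle idfun.
have T_le : (T <= (Num.sqrt n%:R)%:E)%E.
  apply: ub_ereal_sup => _ [s [bs s1] <-]; rewrite lee_fin.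
  apply: le_trans (supnorm_john_le bs) _.
  by rewrite -[leRHS]mulr1 ler_wpM2l ?sqrtr_ge0.
have Tinv_le : (Tinv <= 1)%E.
  apply: ub_ereal_sup => _ [s [bs s1] <-]; rewrite lee_fin.
  exact: le_trans (supnorm_john_ge bs) s1.
(* The zero section lies in both unit balls, so both operator norms are nonnegative and their bounds
   may be multiplied. *)
have bz : @bounded_section R S X B zero.
  split; [exact: zero_continuous | exact: pi_zero |].
  by exists 0 => x; rewrite normb0.
have sz : @supnorm R S X B zero <= 0 by apply: supnorm_le => // x; rewrite normb0.
have T_ge0 : (0 <= T)%E.
  apply: le_trans (ereal_sup_ubound _); last first.
    by exists zero => //; split => //; apply: le_trans sz _.
  by rewrite lee_fin; apply: supnorm_ge0; exact/bounded_john.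
have Tinv_ge0 : (0 <= Tinv)%E.
  apply: le_trans (ereal_sup_ubound _); last first.
    exists zero => //; split => //; apply: le_trans (supnorm_john_le bz) _.
    by apply: le_trans (_ : 0 <= 1) => //; rewrite mulr_ge0_le0 ?sqrtr_ge0.
  by rewrite lee_fin; exact: supnorm_ge0.
have TT : (T * Tinv <= (Num.sqrt n%:R)%:E)%E.
  apply: (@le_trans _ _ ((Num.sqrt n%:R)%:E * 1)%E); last by rewrite mule1.
  exact: lee_pmul.
have inf_le : (ereal_inf [set (@opnorm_T R S X B john_bundle Phi *
    @opnorm_Tinv R S X B john_bundle Phi)%E |
    Phi in [set Phi | @admissible_renorming R S X B john_bundle Phi]] <=
    (Num.sqrt n%:R)%:E)%E.
  apply: le_trans TT; apply: ereal_inf_lbound; exists idfun => //.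
  exact: john_admissible.
rewrite /dbBM; set m := ereal_inf _ in inf_le *.
(* A nonpositive infimum, which occurs for [n = 0], has logarithm [-oo]. Otherwise [n] is positive
   and the logarithm of its square root is half of [ln n]. *)
have [m0|m0] := leP m 0%E; first by rewrite le0_lneNy // leNye.
have sn0 : 0 < Num.sqrt n%:R :> R by rewrite -lte_fin; exact: lt_le_trans inf_le.
have n0 : 0 < n%:R :> R by rewrite -sqrtr_gt0.
have -> : (2^-1 * ln (n%:R : R))%:E = lne (Num.sqrt n%:R)%:E.
  rewrite lne_EFin //; congr EFin.
  have : ln (Num.sqrt n%:R ^+ 2 : R) = ln (n%:R : R) by rewrite sqr_sqrtr // ltW.
  by rewrite lnXn // mulr2n; lra.
by rewrite lee_lne ?in_itv /= ?lee_fin ?sqrtr_ge0 ?leey ?(ltW m0).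
Qed.

End FiberwiseJohn.

(** [john_bundle] is a member of the set. Homogeneity does not involve the norm, so it carries over
    from [B] by conversion. *)
Lemma inf_dbBM_le (R : realType) (S : scalar_field R) (X : topologicalType) n
    (H : hermitian_embedding R (sc_K S)) (B : bundle_data S X) :
  (forall a, sc_abs S a = ab H a) -> (forall r, sc_ofR S r = he_ofR H r) ->
  (forall a, sc_conj S a = he_conj H a) ->
  is_banach_bundle B -> homogeneous B n ->
  (ereal_inf [set d : \bar R | exists B' : bundle_data S X,
      [/\ is_hilbert_bundle B', homogeneous B' n & d = dbBM B B']]
   <= (2^-1 * ln (n%:R : R))%:E)%E.
Proof.
move=> S_abs S_ofR S_conj hB hn.
apply: le_trans (dbBM_john_le S_abs hB hn); apply: ereal_inf_lbound.
exists (john_bundle S_abs hB hn); split => //; first exact: john_bundle_is_hilbert.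
Qed.

Theorem theorem1p9 (R : realType) (S : scalar_field R)
  (HS : S = real_scalars R \/ S = complex_scalars R)
  (X : topologicalType) (n : nat)
  (hX : hausdorff_space X) (lpX : locally_paracompact X)
  (B : bundle_data S X) (hB : is_banach_bundle B) (hn : homogeneous B n) :
  (ereal_inf [set d : \bar R | exists B' : bundle_data S X,
      [/\ is_hilbert_bundle B', homogeneous B' n & d = dbBM B B']]
   <= (2^-1 * ln (n%:R : R))%:E)%E.
Proof.
case: HS => eS; subst S.
  have S_abs a : sc_abs (real_scalars R) a = ab (real_embedding R) a.
    by rewrite /ab /= expr0n /= addr0 sqrtr_sqr.
  exact: inf_dbBM_le S_abs (fun=> erefl) (fun=> erefl) hB hn.
have S_abs a : sc_abs (complex_scalars R) a = ab (complex_embedding R) a by [].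
have S_ofR r : sc_ofR (complex_scalars R) r = he_ofR (complex_embedding R) r by [].
have S_conj a : sc_conj (complex_scalars R) a = he_conj (complex_embedding R) a by [].
exact: inf_dbBM_le S_abs S_ofR S_conj hB hn.
Qed.
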